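(* The center $Z(\mathfrak{o}_N[t])$ of the universal enveloping algebra $U(\mathfrak{o}_N[t])$ is equal to the $p$-center $Z_p(\mathfrak{o}_N[t])$. In particular, $Z(\mathfrak{o}_N[t])$ is freely generated (as a commutative polynomial algebra over $\Bbbk$) by $$\{(F_{i,j}t^r)^p-\delta_{i,j}F_{i,j}t^{rp}\;:\;1\le i,j\le N,\ i+j<N+1,\ r\ge 0\}.$$
   Context: $\Bbbk$ is an algebraically closed field of characteristic $p>3$. $N=2n+1$ with $n\ge1$ (type $B$) or $N=2n$ with $n\ge 2$ (type $D$). Put $i'=N+1-i$ for $1\le i\le N$. The orthogonal Lie algebra $\mathfrak{o}_N\subseteq\mathfrak{gl}_N$ over $\Bbbk$ is the span of $F_{i,j}:=E_{i,j}-E_{j',i'}$, $1\le i,j\le N$, where $E_{i,j}$ are the matrix units; $F_{i,j}+F_{j',i'}=0$. The current algebra is $\mathfrak{o}_N[t]=\mathfrak{o}_N\otimes\Bbbk[t]$ with bracket $[xt^r,yt^s]=[x,y]t^{r+s}$, where $xt^r=x\otimes t^r$; it has basis $F_{i,j}t^r$ with $r\ge0$, $i+j<N+1$. It is a restricted Lie algebra with $p$-map determined by $(xt^r)^{[p]}=x^{[p]}t^{rp}$ for $x\in\mathfrak{o}_N$, where $x^{[p]}$ is the $p$-th matrix power of $x$; in particular $(F_{i,j}t^r)^{[p]}=\delta_{i,j}F_{i,j}t^{rp}$ for these basis elements. The $p$-center $Z_p(\mathfrak{o}_N[t])$ is the subalgebra of $U(\mathfrak{o}_N[t])$ generated by $x^p-x^{[p]}$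 for all $x\in\mathfrak{o}_N[t]$. *)

(* Defs.v *)
From HB Require Import structures.
From mathcomp Require Import all_boot all_order all_algebra.
From mathcomp.multinomials Require Import monalg.

Set Implicit Arguments.
Unset Strict Implicit.
Unset Printing Implicit Defensive.

Import GRing.Theory.
Local Open Scope ring_scope.

Section Enveloping.
Variables (k : fieldType) (L : lmodType k) (br : L -> L -> L).

Definition lie_morphism (A : algType k) (f : L -> A) : Prop :=
  linear f /\ forall x y, f (br x y) = f x * f y - f y * f x.

(* [(U, iota)] is the universal enveloping algebra of [(L, br)]. *)
Definition is_enveloping (U : algType k) (iota : L -> U) : Prop :=
  lie_morphism iota /\
  forall (A : algType k) (f : L -> A), lie_morphism f ->
    exists phi : {lrmorphism U -> A},
      (forall x, phi (iota x) = f x) /\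
      forall psi : {lrmorphism U -> A},
        (forall x, psi (iota x) = f x) -> psi =1 phi.

End Enveloping.

Definition central (A : nzRingType) (z : A) : Prop := forall u : A, z * u = u * z.

Inductive subalgebra_gen (k : fieldType) (A : algType k) (S : A -> Prop) :
    A -> Prop :=
  | Gen_in a : S a -> subalgebra_gen S a
  | Gen_scalar (c : k) : subalgebra_gen S c%:A
  | Gen_add a b : subalgebra_gen S a -> subalgebra_gen S b ->
      subalgebra_gen S (a + b)
  | Gen_mul a b : subalgebra_gen S a -> subalgebra_gen S b ->
      subalgebra_gen S (a * b).

(* The family [g] freely generates the (commutative) subalgebra [B] of [A]:   *)
(* X_i |-> g i is an isomorphism of k[X_i, i in I] onto [B].                  *)
Definition freely_generates (k : fieldType) (A : algType k) (I : choiceType)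
    (g : I -> A) (B : A -> Prop) : Prop :=
  exists phi : {lrmorphism {malg k[{cmonom I}]} -> A},
    [/\ forall i, phi << ucm i >> = g i,
        injective phi
      & forall b, B b <-> exists q, phi q = b].

(* Throughout, N = m.+1; indices are 0-based, so that i' = N + 1 - i becomes  *)
(* [rev_ord i] and the condition i + j < N + 1 becomes [i + j < m].           *)
Section Orthogonal.
Variables (k : fieldType) (m : nat).
Implicit Types (i j : 'I_m.+1) (r : nat).

Definition Fmx i j : 'M[k]_m.+1 :=
  delta_mx i j - delta_mx (rev_ord j) (rev_ord i).

Definition oN : {vspace 'M[k]_m.+1} :=
  <<[seq Fmx ij.1 ij.2 | ij : 'I_m.+1 * 'I_m.+1]>>%VS.

(* o_N[t] = o_N (x) k[t]: polynomials in a central variable t over the        *)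
(* associative algebra M_N(k) all of whose coefficients lie in o_N; the       *)
(* element x t^r is [x *: 'X^r].                                              *)
Record oNt : predArgType :=
  ONt { poly_of_oNt :> {poly 'M[k]_m.+1}; _ : poly_of_oNt \is a polyOver oN }.

HB.instance Definition _ := [isSub for poly_of_oNt].
HB.instance Definition _ := [Choice of oNt by <:].
HB.instance Definition _ := [SubChoice_isSubZmodule of oNt by <:].

Lemma oNtP (x : oNt) : poly_of_oNt x \is a polyOver oN.
Proof. exact: valP. Qed.

Lemma scale_oNt_subproof (c : k) (x : oNt) :
  c%:M *: poly_of_oNt x \is a polyOver oN.
Proof.
apply/polyOverP=> n; rewrite coefZ -[_ * _]/(_ *m _) mul_scalar_mx.
by rewrite memvZ// (polyOverP (oNtP x)).
Qed.

(* Scalars act on {poly 'M[k]_N} through scalar matrices. *)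
Definition scale_oNt (c : k) (x : oNt) : oNt := ONt (scale_oNt_subproof c x).

Lemma scale_oNtA a b (x : oNt) : scale_oNt a (scale_oNt b x) = scale_oNt (a * b) x.
Proof. by apply: val_inj; rewrite /= scalerA scalar_mxM. Qed.
Lemma scale_oNt1 : left_id 1 scale_oNt.
Proof. by move=> x; apply: val_inj; rewrite /= scale1r. Qed.
Lemma scale_oNtDr : right_distributive scale_oNt +%R.
Proof. by move=> c x y; apply: val_inj; rewrite /= scalerDr. Qed.
Lemma scale_oNtDl (x : oNt) : {morph scale_oNt^~ x : a b / a + b}.
Proof. by move=> a b; apply: val_inj; rewrite /= raddfD scalerDl. Qed.

HB.instance Definition _ := GRing.Zmodule_isLmodule.Build k oNt
  scale_oNtA scale_oNt1 scale_oNtDr scale_oNtDl.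

Lemma xt_subproof (x : 'M[k]_m.+1) r :
  x \in oN -> x *: 'X^r \is a polyOver oN.
Proof.
move=> xo; apply/polyOverP=> n; rewrite coefZ coefXn mulr_natr.
by rewrite rpredMn.
Qed.

Definition xt (x : subvs_of oN) r : oNt := ONt (xt_subproof r (subvsP x)).

Lemma Fmx_oN i j : Fmx i j \in oN.
Proof. by apply: memv_span; apply/imageP; exists (i, j). Qed.

Definition Ft i j r : oNt := ONt (xt_subproof r (Fmx_oN i j)).

(* The anti-involution E_{i,j} |-> E_{j',i'}; elements of o_N are the         *)
(* z - sigma z.                                                               *)
Definition sigma (A : 'M[k]_m.+1) : 'M[k]_m.+1 :=
  \matrix_(i, j) A (rev_ord j) (rev_ord i).

Fact sigma_is_linear : linear sigma.
Proof. by move=> a A B; apply/matrixP=> i j; rewrite !mxE. Qed.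
HB.instance Definition _ := GRing.isLinear.Build k _ _ _ sigma sigma_is_linear.

Lemma sigmaZ a A : sigma (a *: A) = a *: sigma A.
Proof. by apply/matrixP=> i j; rewrite !mxE. Qed.

Lemma sigmaK : involutive sigma.
Proof. by move=> A; apply/matrixP=> i j; rewrite !mxE !rev_ordK. Qed.

Lemma sigmaM A B : sigma (A * B) = sigma B * sigma A.
Proof.
apply/matrixP=> i j; rewrite !mxE (reindex_inj rev_ord_inj) /=.
by apply: eq_bigr => l _; rewrite !mxE mulrC.
Qed.

Lemma sigma_delta i j : sigma (delta_mx i j) = delta_mx (rev_ord j) (rev_ord i).
Proof.
apply/matrixP=> a b; rewrite !mxE !(can2_eq (@rev_ordK _) (@rev_ordK _)).
by rewrite andbC.
Qed.

Lemma oN_sigmaP A : (A \in oN) <-> exists z, A = z - sigma z.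
Proof.
split=> [|[z ->]].
  rewrite /oN => /(@coord_span _ _ _ (in_tuple _)) ->.
  pose P B := exists z, B = z - sigma z.
  apply: (big_ind P); first by exists 0; rewrite raddf0 subr0.
    by move=> B C [y ->] [z ->]; exists (y + z); rewrite raddfD opprD addrACA.
  move=> l _; set c := coord _ _ _; set B := nth _ _ _.
  have : B \in [seq Fmx ij.1 ij.2 | ij : 'I_m.+1 * 'I_m.+1].
    by apply: mem_nth; case: l {c B}.
  case/imageP=> -[i j] _ -> /=; exists (c *: delta_mx i j).
  by rewrite sigmaZ sigma_delta -scalerBr.
rewrite [z]matrix_sum_delta (raddf_sum sigma) -sumrB rpred_sum // => i _.
rewrite (raddf_sum sigma) -sumrB rpred_sum // => j _.
by rewrite /= sigmaZ sigma_delta -scalerBr memvZ // Fmx_oN.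
Qed.

Notation sigmaP := (map_poly sigma).

Lemma sigmaPK : involutive sigmaP.
Proof. by move=> q; apply/polyP=> n; rewrite !coef_map /= sigmaK. Qed.

Lemma sigmaPM (q r : {poly 'M[k]_m.+1}) : sigmaP (q * r) = sigmaP r * sigmaP q.
Proof.
apply/polyP=> n; rewrite coef_map coefM coefMr raddf_sum.
by apply: eq_bigr => l _; rewrite !coef_map /= sigmaM.
Qed.

Lemma oNt_sigmaP (q : {poly 'M[k]_m.+1}) :
  (q \is a polyOver oN) <-> exists z, q = z - sigmaP z.
Proof.
split=> [/polyOverP qo|[z ->]]; last first.
  apply/polyOverP=> n; rewrite coefB coef_map.
  by apply/oN_sigmaP; exists z`_n.
pose P B := exists z, B = z - sigmaP z.
rewrite -[q]coefK poly_def; apply: (big_ind P).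
- by exists 0; rewrite raddf0 subr0.
- by move=> B C [y ->] [z ->]; exists (y + z); rewrite raddfD opprD addrACA.
move=> n _; have /oN_sigmaP[z ->] := qo n; exists (z *: 'X^n).
apply/polyP=> l; rewrite coefB coef_map !coefZ !coefXn.
by case: eqP => _; rewrite ?mulr1 // !mulr0 raddf0 subr0.
Qed.

Lemma sigmaP_oNt (x : oNt) : sigmaP x = - (x : {poly _}).
Proof.
by have /oNt_sigmaP[z ->] := oNtP x; rewrite raddfB /= sigmaPK opprB.
Qed.

Lemma lie_oNt_subproof (x y : oNt) :
  (x : {poly _}) * y - (y : {poly _}) * x \is a polyOver oN.
Proof.
apply/oNt_sigmaP; exists ((x : {poly _}) * y).
by rewrite sigmaPM !sigmaP_oNt mulrNN.
Qed.

Definition lie_oNt (x y : oNt) : oNt := ONt (lie_oNt_subproof x y).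

Lemma monom_mul (a b : 'M[k]_m.+1) r s :
  (a *: 'X^r) * (b *: 'X^s) = (a * b) *: 'X^(r + s).
Proof.
by rewrite -scalerAl -[b *: _]mul_polyC mulrA -commr_polyXn -mulrA -exprD
   mul_polyC scalerA.
Qed.

Lemma lie_oNt_xt (x y z : subvs_of oN) r s :
  vsval z = vsval x * vsval y - vsval y * vsval x ->
  lie_oNt (xt x r) (xt y s) = xt z (r + s).
Proof.
by move=> zE; apply: val_inj; rewrite /= zE !monom_mul [(s + r)%N]addnC scalerBl.
Qed.

Lemma oNt_exp_odd p (x : oNt) : odd p ->
  poly_of_oNt x ^+ p \is a polyOver oN.
Proof.
move=> p_odd; have [z xE] := (oNt_sigmaP x).1 (oNtP x).
set q := (x : {poly _}) ^+ p./2; set h := (-1) ^+ p./2 : {poly 'M[k]_m.+1}.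
have sq : sigmaP q = h * q.
  rewrite {}/q {}/h; elim: (p./2) => [|n IHn].
    rewrite !expr0 mulr1; apply/polyP=> n; rewrite coef_map coef1.
    case: eqP => _ /=; last by rewrite raddf0.
    by apply/matrixP=> i j; rewrite !mxE (inj_eq rev_ord_inj) eq_sym.
  rewrite [in LHS]exprSr sigmaPM IHn sigmaP_oNt mulrA commr_sign -mulrA.
  by rewrite mulNr -exprS -[- (_ ^+ _)]mulN1r mulrA -exprSr.
have -> : poly_of_oNt x ^+ p = h * (sigmaP q * x * q).
  rewrite sq !mulrA /h -exprD addnn -muln2 exprM sqrr_sign mul1r.
  rewrite -{1}(odd_double_half p) p_odd -addnn addnA addnC exprD.
  by rewrite add1n exprS mulrA.
suff : sigmaP q * x * q \is a polyOver oN.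
  move=> /polyOverP w; rewrite /h -signr_odd; case: odd => /=.
    by rewrite expr1 mulN1r rpredN; apply/polyOverP.
  by rewrite expr0 mul1r; apply/polyOverP.
apply/oNt_sigmaP; exists (sigmaP q * z * q).
by rewrite !sigmaPM sigmaPK xE mulrBr mulrBl !mulrA.
Qed.

(* The p-map of o_N[t] in characteristic p > 2: the restriction of the p-th   *)
(* power of the associative algebra M_N(k)[t], see [val_pmap] (for odd p the  *)
(* default value 0 does not occur). It is the p-map with (x t^r)^[p] =        *)
(* x^p t^(rp), see [pmap_xt]; the values on the x t^r determine it.           *)
Definition pmap p (x : oNt) : oNt := insubd 0 (poly_of_oNt x ^+ p).

Lemma val_pmap p (x : oNt) : odd p -> pmap p x = poly_of_oNt x ^+ p :> {poly _}.
Proof. by move=> p_odd; rewrite /pmap [LHS]insubdK //; apply: oNt_exp_odd. Qed.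

Lemma pmap_xt p (x : subvs_of oN) r : odd p ->
  pmap p (xt x r) = (vsval x ^+ p) *: 'X^(r * p) :> {poly _}.
Proof.
move=> p_odd; rewrite val_pmap //= -!mul_polyC exprMn_comm; last first.
  exact: commr_polyXn.
by rewrite exprM polyC_exp.
Qed.

(* The (i, j, r) such that the F_{i,j} t^r form a basis of o_N[t]. *)
Definition basis_idx : Type :=
  ({ij : 'I_m.+1 * 'I_m.+1 | (ij.1 + ij.2 < m)%N} * nat)%type.
HB.instance Definition _ := Choice.on basis_idx.

Section PCenter.
Variables (U : algType k) (iota : oNt -> U) (p : nat).

Definition p_center : U -> Prop :=
  subalgebra_gen (fun u => exists x, u = iota x ^+ p - iota (pmap p x)).

Definition p_center_gen (a : basis_idx) : U :=
  let: (i, j) := val a.1 in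
  iota (Ft i j a.2) ^+ p - (i == j)%:R *: iota (Ft i j (a.2 * p)).

End PCenter.

End Orthogonal.

(* Main.v *)
(* U(o_N[t]) is identified, by PBW, with the module S = S(o_N[t]) over itself *)

(* The algebra $U$ is compared, by degree, with the polynomial ring $S$ on the basis of
   $\mathfrak{o}_N[t]$. This needs PBW, proved for a Lie algebra with a totally ordered basis:
   [rho_rep] makes a recursively defined action of $L$ on $S$ a representation, [Psi_rho] shows that
   this module is universal among cyclic ones, and [pbw] deduces an injective linear $\theta:U\to S$
   compatible with the actions of $L$. As $x$ acts by multiplication up to lower degree, commutators
   in $U$ turn into Poisson brackets of symbols ([symbol_comm]), so the top part of a central
   element is Poisson invariant ([central_Dlie]).

   The center is bounded from above by [polar_dvd]: bracketing with $Ft^s$ for large $s$ produces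
   fresh variables, which splits the invariance into statements that certain matrices of derivative
   coefficients centralize $\mathfrak{o}_N$. They vanish by [oN_center], so all exponents in the top
   part are divisible by $p$. It is bounded from below by $\mathrm{ad}(x)^p=\mathrm{ad}(x^p)$, valid
   in $U$ and in $M_N(\Bbbk)[t]$ ([iter_ad_pchar]), which makes $x^p-x^{[p]}$ central.

   For basis elements the symbols of these elements are the $p$-th powers of the variables. The two
   bounds therefore meet by induction on the degree ([central_xi_slextP]), and comparison of symbols
   gives independence ([xi_slext_inj]); [enveloping_center] combines both. *)
(* generated by 1; x acts on S as multiplication by x up to terms of lower    *)
(* degree. If u is central, the leading part of its image f in S is then      *)
(* killed by all Poisson brackets {x t^s, -}. Taking s larger than every      *)
(* power of t in f, the elements [x, F] t^(r+s) are new variables, so that    *)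
(* each sum over the basis elements F of F (x) df/d(F t^r) commutes with all  *)
(* x in o_N. As o_N has trivial center, all partial derivatives of the        *)
(* leading part vanish: its monomials are p-th powers, i.e. symbols of        *)
(* products of the central elements (F t^r)^p - (F t^r)^[p]. Subtracting such *)
(* products, induction on the degree shows that these elements generate the   *)
(* center; comparing leading terms shows that they are algebraically          *)
(* independent.                                                               *)
Require Import Defs.
From HB Require Import structures.
From mathcomp Require Import all_boot all_order all_algebra.
From mathcomp Require Import finmap zify.
From mathcomp.multinomials Require Import monalg.

Set Implicit Arguments.
Unset Strict Implicit.
Unset Printing Implicit Defensive.

Import GRing.Theory.
Local Open Scope ring_scope.

(** * Polynomial algebras and their monomials *)

(* Both definitions are sealed to keep unification from unfolding them. *)
HB.lock Definition zm (k : fieldType) (K : choiceType) (i : K) : {malg k[K]} :=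
  << i >>.

HB.lock Definition lext (k : fieldType) (K : choiceType) (V : lmodType k)
    (h : K -> V) (g : {malg k[K]}) : V :=
  \sum_(i <- msupp g) g@_i *: h i.

Arguments zm {k K}.
Arguments lext {k K V}.

Section LinearExtension.
Variables (k : fieldType) (K : choiceType) (V : lmodType k).
Implicit Types (h : K -> V) (g : {malg k[K]}).

Lemma lextE h g : lext h g = \sum_(i <- msupp g) g@_i *: h i.
Proof. by rewrite lext.unlock. Qed.

Lemma mcoeff_zm i j : (zm i : {malg k[K]})@_j = (i == j)%:R.
Proof. by rewrite zm.unlock mcoeffU. Qed.

Lemma lextEw (d : {fset K}) h g : (msupp g `<=` d)%fset ->
  lext h g = \sum_(i <- d) g@_i *: h i.
Proof.
move=> le; rewrite lextE (big_fset_incl _ le) // => i _ /mcoeff_outdom ->.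
by rewrite scale0r.
Qed.

Fact lext_is_linear h : linear (lext h).
Proof.
move=> a f g; pose d := (msupp f `|` msupp g `|` msupp (a *: f + g))%fset.
have df : (msupp f `<=` d)%fset by rewrite /d -fsetUA fsubsetUl.
have dg : (msupp g `<=` d)%fset by rewrite /d fsetUAC fsubsetUr.
have ds : (msupp (a *: f + g) `<=` d)%fset by rewrite fsubsetUr.
rewrite !(lextEw _ df, lextEw _ dg, lextEw _ ds) scaler_sumr -big_split /=.
by apply: eq_bigr => i _; rewrite mcoeffD mcoeffZ scalerDl scalerA.
Qed.
HB.instance Definition _ h := GRing.isLinear.Build k {malg k[K]} V _ (lext h)
  (lext_is_linear h).

Lemma lextU h i : lext h (zm i) = h i.
Proof.
by rewrite zm.unlock (lextEw _ msuppU_le) big_seq_fset1 mcoeffUU scale1r.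
Qed.

Lemma malg_sum g : g = \sum_(i <- msupp g) g@_i *: zm i.
Proof.
rewrite {1}[g]monalgE; apply: eq_bigr => i _.
by apply/malgP=> j; rewrite mcoeffZ mcoeff_zm mcoeffU mulr_natr.
Qed.

Lemma linear_malg_eq (f1 f2 : {linear {malg k[K]} -> V}) :
  (forall i, f1 (zm i) = f2 (zm i)) -> f1 =1 f2.
Proof.
move=> f12 g; rewrite [g]malg_sum !linear_sum; apply: eq_bigr => i _.
by rewrite !linearZ /= f12.
Qed.

End LinearExtension.

(** * Monomials as sorted words *)

Section MonomialWord.
Variables (I : choiceType) (le : rel I).
Hypotheses (le_total : total le) (le_trans : transitive le).
Hypothesis (le_anti : antisymmetric le).
Implicit Types (m : {cmonom I}) (s : seq I).

Definition mon s : {cmonom I} := \big[mmul/mone]_(i <- s) ucm i.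

Lemma mon_cons i s : mon (i :: s) = mmul (ucm i) (mon s).
Proof. by rewrite /mon big_cons. Qed.

Lemma monE s i : mon s i = count_mem i s.
Proof.
elim: s => [|j s IHs]; first by rewrite /mon big_nil cm1.
by rewrite mon_cons cmM cmU IHs.
Qed.

Lemma mdeg_mon s : mdeg (mon s) = size s.
Proof.
elim: s => [|j s IHs]; first by rewrite /mon big_nil mdeg1.
by rewrite mon_cons mdegM mdegU IHs.
Qed.

Definition cseq m : seq I := sort le (flatten [seq nseq (m i) i | i <- finsupp m]).

Lemma count_cseq m i : count_mem i (cseq m) = m i.
Proof.
rewrite count_sort count_flatten -map_comp sumnE big_map /=.
under eq_bigr do rewrite count_nseq /=.
have [im|im] := boolP (i \in finsupp m).
  rewrite (big_fsetD1 i) //= eqxx mul1n big1_fset ?addn0 // => j.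
  by rewrite !inE => /andP[/negPf->].
rewrite big1_fset; first by apply/esym/eqP; rewrite cmE_eq0.
by move=> j jm _; case: eqVneq => // ji; rewrite -ji jm in im.
Qed.

Lemma mem_cseq m i : (i \in cseq m) = (m i != 0)%N.
Proof. by rewrite -has_pred1 has_count count_cseq lt0n. Qed.

Lemma cseqK : cancel cseq mon.
Proof. by move=> m; apply/eqP/cmP=> i; rewrite monE count_cseq. Qed.

Lemma size_cseq m : size (cseq m) = mdeg m.
Proof. by rewrite -mdeg_mon cseqK. Qed.

Lemma cseq_sorted m : sorted le (cseq m).
Proof. exact: sort_sorted. Qed.

Lemma monK s : sorted le s -> cseq (mon s) = s.
Proof.
move=> s_sorted; apply: (sorted_eq le_trans le_anti) => //.
  exact: cseq_sorted.
by apply/allP=> i _; rewrite /= count_cseq monE.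
Qed.

Lemma perm_cseqM i m : perm_eq (cseq (mmul (ucm i) m)) (i :: cseq m).
Proof. by apply/allP=> j _; rewrite /= !count_cseq cmM cmU. Qed.

End MonomialWord.
(* The polynomial algebra, sealed to keep unification from computing in it. *)
Lemma symalg_key (k : fieldType) (I : choiceType) :
  {S : comAlgType k & {f : {lrmorphism {malg k[{cmonom I}]} -> S} &
    {g : {linear S -> {malg k[{cmonom I}]}} | cancel f g & cancel g f}}}.
Proof. by exists {malg k[{cmonom I}]}, idfun, idfun. Qed.

Definition symalg (k : fieldType) (I : choiceType) : comAlgType k :=
  projT1 (symalg_key k I).

Section SymmetricAlgebra.
Variables (k : fieldType) (I : choiceType).
Local Notation S := (symalg k I).
Implicit Types (m : {cmonom I}) (f g : S).

Definition of_malg : {lrmorphism {malg k[{cmonom I}]} -> S} :=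
  projT1 (projT2 (symalg_key k I)).

Definition to_malg : {linear S -> {malg k[{cmonom I}]}} :=
  s2val (projT2 (projT2 (symalg_key k I))).

Lemma of_malgK : cancel of_malg to_malg.
Proof. exact: s2valP (projT2 (projT2 (symalg_key k I))). Qed.

Lemma to_malgK : cancel to_malg of_malg.
Proof. exact: s2valP' (projT2 (projT2 (symalg_key k I))). Qed.

Definition zs m : S := of_malg (zm m).
Definition scoef m f : k := (to_malg f)@_m.
Definition ssupp f : seq {cmonom I} := msupp (to_malg f).
Definition slext (V : lmodType k) (h : {cmonom I} -> V) : S -> V :=
  lext h \o to_malg.
HB.instance Definition _ (V : lmodType k) (h : {cmonom I} -> V) :=
  GRing.Linear.on (slext h).

Lemma scoef0 m : scoef m 0 = 0.
Proof. by rewrite /scoef linear0 mcoeff0. Qed.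

Lemma scoefD m f g : scoef m (f + g) = scoef m f + scoef m g.
Proof. by rewrite /scoef linearD mcoeffD. Qed.

Lemma scoefN m f : scoef m (- f) = - scoef m f.
Proof. by rewrite /scoef linearN mcoeffN. Qed.

Lemma scoefZ m a f : scoef m (a *: f) = a * scoef m f.
Proof. by rewrite /scoef linearZ mcoeffZ. Qed.

Lemma scoef_sum m (T : Type) (r : seq T) (P : pred T) (F : T -> S) :
  scoef m (\sum_(i <- r | P i) F i) = \sum_(i <- r | P i) scoef m (F i).
Proof. by rewrite /scoef linear_sum raddf_sum. Qed.

Lemma scoef_zs m m' : scoef m' (zs m) = (m == m')%:R.
Proof. by rewrite /scoef of_malgK mcoeff_zm. Qed.

Lemma scoef_neq0 m f : (scoef m f != 0) = (m \in ssupp f).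
Proof. exact: mcoeff_neq0. Qed.

Lemma ssupp_uniq f : uniq (ssupp f).
Proof. exact: fset_uniq. Qed.

Lemma symalg_sum f : f = \sum_(m <- ssupp f) scoef m f *: zs m.
Proof.
rewrite -{1}[f]to_malgK [to_malg f]malg_sum linear_sum; apply: eq_bigr => m _.
by rewrite linearZ.
Qed.

Lemma slextE (V : lmodType k) (h : {cmonom I} -> V) f :
  slext h f = \sum_(m <- ssupp f) scoef m f *: h m.
Proof. by rewrite /slext /= lextE. Qed.

Lemma slextU (V : lmodType k) (h : {cmonom I} -> V) m : slext h (zs m) = h m.
Proof. by rewrite /slext /= of_malgK lextU. Qed.

Lemma zsM m1 m2 : zs m1 * zs m2 = zs (mmul m1 m2).
Proof. by rewrite /zs -rmorphM zm.unlock malgM_def fgmulUU mulr1. Qed.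

Lemma of_malgU m : of_malg << m >> = zs m.
Proof. by rewrite /zs zm.unlock. Qed.

Lemma zs1 : zs mone = 1.
Proof. by rewrite -of_malgU -[RHS](rmorph1 of_malg). Qed.

Lemma linear_symalg_eq (V : lmodType k) (f1 f2 : {linear S -> V}) :
  (forall m, f1 (zs m) = f2 (zs m)) -> f1 =1 f2.
Proof.
move=> f12 g; rewrite [g]symalg_sum !linear_sum; apply: eq_bigr => i _.
by rewrite !linearZ /= f12.
Qed.

Lemma zs1_neq0 : zs mone != 0.
Proof.
apply/eqP => /(congr1 (scoef mone)); rewrite scoef_zs scoef0 eqxx.
by move/eqP; rewrite oner_eq0.
Qed.

End SymmetricAlgebra.

Arguments to_malg {k I}.
Arguments of_malg {k I}.
Arguments scoef {k I}.
Arguments ssupp {k I}.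
Arguments symalg_sum {k I}.
Arguments zsM {k I}.
Arguments zs1 {k I}.
Arguments of_malgU {k I}.

(** * The degree filtration of the polynomial ring *)

Section DegreeFiltration.
Variables (k : fieldType) (I : choiceType).
Local Notation S := (symalg k I).
Local Notation zs := (@zs k I).
Implicit Types (m : {cmonom I}) (f g : S) (d : nat).

(** The bound is strict, so that $d=0$ forces $g=0$ and inductions on the degree can start there. *)
Definition ltdeg d g := forall m, (d <= mdeg m)%N -> scoef m g = 0.

Lemma ltdeg0 d : ltdeg d 0.
Proof. by move=> m _; rewrite scoef0. Qed.

Lemma ltdegD d f g : ltdeg d f -> ltdeg d g -> ltdeg d (f + g).
Proof. by move=> df dg m dm; rewrite scoefD df ?dg ?addr0. Qed.

Lemma ltdegN d g : ltdeg d g -> ltdeg d (- g).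
Proof. by move=> dg m dm; rewrite scoefN dg ?oppr0. Qed.

Lemma ltdegB d f g : ltdeg d f -> ltdeg d g -> ltdeg d (f - g).
Proof. by move=> df dg; apply/ltdegD/ltdegN. Qed.

Lemma ltdegZ d a g : ltdeg d g -> ltdeg d (a *: g).
Proof. by move=> dg m dm; rewrite scoefZ dg ?mulr0. Qed.

Lemma ltdeg_sum d (T : eqType) (r : seq T) (P : pred T) (F : T -> S) :
  (forall i, i \in r -> P i -> ltdeg d (F i)) -> ltdeg d (\sum_(i <- r | P i) F i).
Proof.
move=> dF; rewrite big_seq_cond; apply: big_ind.
- exact: ltdeg0.
- exact: ltdegD.
- by move=> i /andP[]; apply: dF.
Qed.

Lemma ltdegW d d' g : (d <= d')%N -> ltdeg d g -> ltdeg d' g.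
Proof. by move=> dd' dg m dm; apply/dg/(leq_trans dd'). Qed.

Lemma ltdegU d m : (mdeg m < d)%N -> ltdeg d (zs m).
Proof.
by move=> md m' dm'; rewrite scoef_zs; case: eqVneq md => // ->; rewrite ltnNge dm'.
Qed.

Lemma ltdeg_ssupp d g m : ltdeg d g -> m \in ssupp g -> (mdeg m < d)%N.
Proof. by move=> dg; rewrite -scoef_neq0 ltnNge; apply: contra => /dg ->. Qed.

Lemma ltdeg_exists g : exists d, ltdeg d g.
Proof.
by exists (msize (to_malg g)) => m /msize_mdeg_ge; rewrite -mcoeff_eq0 => /eqP.
Qed.

Lemma ltdeg_slext d d' (h : {cmonom I} -> S) g :
  (forall m, (mdeg m < d)%N -> ltdeg d' (h m)) -> ltdeg d g ->
  ltdeg d' (slext h g).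
Proof.
move=> dh dg; rewrite slextE; apply: ltdeg_sum => m mg _.
by apply/ltdegZ/dh/(ltdeg_ssupp dg).
Qed.

Lemma eq_ltdeg_linear (V : lmodType k) (f1 f2 : {linear S -> V}) d :
  (forall m, (mdeg m < d)%N -> f1 (zs m) = f2 (zs m)) ->
  forall g, ltdeg d g -> f1 g = f2 g.
Proof.
move=> f12 g dg; rewrite [g]symalg_sum !linear_sum.
rewrite big_seq [RHS]big_seq; apply: eq_bigr => i ig.
by rewrite !linearZ /= f12 // (ltdeg_ssupp dg).
Qed.

Lemma ltdegM d1 d2 f g : ltdeg d1.+1 f -> ltdeg d2 g -> ltdeg (d1 + d2) (f * g).
Proof.
move=> df dg; rewrite [f]symalg_sum [g]symalg_sum mulr_suml.
apply: ltdeg_sum => m1 /(ltdeg_ssupp df); rewrite ltnS => m1d _.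
rewrite mulr_sumr; apply: ltdeg_sum => m2 /(ltdeg_ssupp dg) m2d _.
rewrite -scalerAl -scalerAr zsM; apply/ltdegZ/ltdegZ/ltdegU.
by rewrite mdegM -ltnS ltnS -addnS leq_add.
Qed.

End DegreeFiltration.

(** * The Poincare-Birkhoff-Witt theorem *)

(* An alias that forgets the commutative product, so that it can carry the    *)
(* product of the enveloping algebra.                                         *)
Definition env_space (k : fieldType) (I : choiceType) : Type := symalg k I.
HB.instance Definition _ (k : fieldType) (I : choiceType) :=
  GRing.Lmodule.copy (env_space k I) (symalg k I).

Section PBW.
Variables (k : fieldType) (I : choiceType) (le : rel I).
Hypotheses (le_total : total le) (le_trans : transitive le).
Hypothesis (le_anti : antisymmetric le).
Variables (L : lmodType k) (br : L -> L -> L) (e : I -> L).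
Variable (cof : {linear L -> {malg k[I]}}).
Hypotheses (cof_inj : injective cof) (cofe : forall i, cof (e i) = zm i).
Hypothesis br_linl : forall y, linear (br^~ y).
Hypothesis br_linr : forall x, linear (br x).
Hypothesis br_alt : forall x, br x x = 0.
Hypothesis br_jacobi : forall x y z,
  br x (br y z) + br y (br z x) + br z (br x y) = 0.

Local Notation S := (symalg k I).
Local Notation zs := (@zs k I).
Local Notation cseq := (cseq le).
Implicit Types (i j l : I) (m : {cmonom I}) (s : seq I) (g : S) (x y : L).

Lemma br_anti x y : br x y = - br y x.
Proof.
have Dl u v w : br (u + v) w = br u w + br v w.
  by have := br_linl w 1 u v; rewrite !scale1r.
have Dr u v w : br w (u + v) = br w u + br w v.
  by have := br_linr w 1 u v; rewrite !scale1r.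
apply/eqP; rewrite -addr_eq0; apply/eqP; have := br_alt (x + y).
by rewrite Dl !Dr !br_alt add0r addr0.
Qed.

Lemma brNr x y : br x (- y) = - br x y.
Proof.
pose f : {linear L -> L} :=
  HB.pack (br x) (GRing.isLinear.Build k _ _ _ (br x) (br_linr x)).
exact: (linearN f).
Qed.

Lemma lext_cof x : x = lext e (cof x).
Proof.
apply: cof_inj; rewrite -[LHS]/(idfun (cof x)).
by apply: (linear_malg_eq (f2 := cof \o lext e)) => i /=; rewrite lextU cofe.
Qed.

Lemma linear_basis_eq (V : lmodType k) (f1 f2 : L -> V) :
  linear f1 -> linear f2 -> (forall i, f1 (e i) = f2 (e i)) -> f1 =1 f2.
Proof.
move=> lf1 lf2 f12 x; rewrite (lext_cof x) lextE.
pose F1 : {linear L -> V} := HB.pack f1 (GRing.isLinear.Build k _ _ _ f1 lf1).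
pose F2 : {linear L -> V} := HB.pack f2 (GRing.isLinear.Build k _ _ _ f2 lf2).
rewrite -[f1 _]/(F1 _) -[f2 _]/(F2 _) !linear_sum; apply: eq_bigr => i _.
by rewrite !linearZ /= f12.
Qed.

(* For [i] larger than the least letter [j] of [m = z_j z_s], the recursion   *)
(* is x_i z_j z_s = x_j (x_i z_s) + [x_i, x_j] z_s, where the leading term    *)
(* z_i z_s of x_i z_s is treated apart because its degree is not smaller. The *)
(* fuel only has to reach the degree of [m], see [actW].                      *)
Fixpoint act (n : nat) i m : S :=
  if n isn't n'.+1 then zs (mmul (ucm i) m) else
  if cseq m is j :: s then
    if le i j then zs (mmul (ucm i) m) else
    zs (mmul (ucm i) m)
    + slext (act n' j) (act n' i (mon s) - zs (mmul (ucm i) (mon s)))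
    + lext (fun c => act n' c (mon s)) (cof (br (e i) (e j)))
  else zs (mmul (ucm i) m).

Lemma actE n i m : act n.+1 i m =
  if cseq m is j :: s then
    if le i j then zs (mmul (ucm i) m) else
    zs (mmul (ucm i) m)
    + slext (act n j) (act n i (mon s) - zs (mmul (ucm i) (mon s)))
    + lext (fun c => act n c (mon s)) (cof (br (e i) (e j)))
  else zs (mmul (ucm i) m).
Proof. by []. Qed.

Lemma cseq_cons m j s : cseq m = j :: s ->
  [/\ m = mmul (ucm j) (mon s), mdeg m = (size s).+1, sorted le s
    & all (le j) s].
Proof.
move=> ms; have := cseq_sorted le_total m; rewrite ms /= path_sortedE //.
by case/andP=> js s_sorted; rewrite -(size_cseq le) -{1}(cseqK le m) ms mon_cons.
Qed.

(** Independence of the fuel and the shape of the leading term are proved together: the recursion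
    runs over the monomials of a remainder, and only the degree bound on that remainder ensures that
    the fuel suffices. *)
Lemma actS n i m : (mdeg m <= n)%N ->
  act n.+1 i m = act n i m /\
  ltdeg (mdeg m).+1 (act n i m - zs (mmul (ucm i) m)).
Proof.
elim: n i m => [|n IHn] i m.
  rewrite leqn0 => /eqP m0; have cm : cseq m = [::].
    by apply: size0nil; rewrite size_cseq.
  by rewrite /= cm subrr; split=> //; apply: ltdeg0.
move=> mn; rewrite (actE n.+1) (actE n).
case cm: (cseq m) => [|j s]; first by rewrite subrr; split=> //; apply: ltdeg0.
have [mE dm _ _] := cseq_cons cm; rewrite dm ltnS in mn.
case: (le i j); first by rewrite subrr; split=> //; apply: ltdeg0.
have dsn : (mdeg (mon s) <= n)%N by rewrite mdeg_mon.
have [actE' low] := IHn i (mon s) dsn.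
rewrite mdeg_mon in low.
have lowj d m' l : (mdeg m' < d)%N -> (d <= n.+1)%N -> ltdeg d.+1 (act n l m').
  move=> md dn; rewrite -[act n l m'](subrK (zs (mmul (ucm l) m'))).
  have [] := IHn l m' (leq_trans md dn) => _ low'.
  apply: ltdegD; first by apply: ltdegW low'; rewrite ltnS ltnW.
  by apply: ltdegU; rewrite mdegM mdegU.
split; last first.
  have E (a b c : S) : a + b + c - a = b + c by rewrite addrC !addrA addNr add0r.
  rewrite E dm.
  apply: ltdegD.
    apply: ltdeg_slext => [m' |]; last exact: low.
    by move=> m's; apply: lowj.
  by rewrite lextE; apply: ltdeg_sum => c _ _; apply/ltdegZ/lowj; rewrite ?mdeg_mon.
have -> : slext (act n.+1 j) (act n.+1 i (mon s) - zs (mmul (ucm i) (mon s))) =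
    slext (act n j) (act n i (mon s) - zs (mmul (ucm i) (mon s))).
  rewrite actE'; apply: eq_ltdeg_linear low => m' m's; rewrite /= !slextU.
  by apply: (IHn j m' _).1; rewrite -ltnS (leq_trans m's).
have -> // : lext (fun c => act n.+1 c (mon s)) (cof (br (e i) (e j))) =
    lext (fun c => act n c (mon s)) (cof (br (e i) (e j))).
by rewrite !lextE; apply: eq_bigr => c _; rewrite (IHn c (mon s) dsn).1.
Qed.

Lemma actW n i m : (mdeg m <= n)%N -> act n i m = act (mdeg m) i m.
Proof.
elim: n => [|n IHn]; first by rewrite leqn0 => /eqP->.
by rewrite leq_eqVlt ltnS => /predU1P[-> //|mn]; rewrite (actS i mn).1 IHn.
Qed.

Definition rhoi i : S -> S := slext (fun m => act (mdeg m) i m).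
HB.instance Definition _ i := GRing.Linear.on (rhoi i).

Definition rho x g : S := lext (rhoi^~ g) (cof x).

Fact rho_is_linear x : linear (rho x).
Proof.
move=> a f g; rewrite /rho !lextE scaler_sumr -big_split /=.
apply: eq_bigr => i _.
by rewrite linearP scalerDr !scalerA mulrC.
Qed.
HB.instance Definition _ x := GRing.isLinear.Build k S S _ (rho x)
  (rho_is_linear x).

Lemma rho_linl g : linear (rho^~ g).
Proof. by move=> a x y; rewrite /rho linearP linearP. Qed.

Lemma rhoDl x y g : rho (x + y) g = rho x g + rho y g.
Proof. by rewrite /rho !raddfD. Qed.

Lemma rhoNl x g : rho (- x) g = - rho x g.
Proof. by rewrite /rho !raddfN. Qed.

Lemma rho_e i g : rho (e i) g = rhoi i g.
Proof. by rewrite /rho cofe lextU. Qed.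

Definition zlin : L -> S := lext (fun c => zs (ucm c)) \o cof.
HB.instance Definition _ := GRing.Linear.on zlin.

Lemma rhoi_low i d g : ltdeg d g -> ltdeg d (rhoi i g - zs (ucm i) * g).
Proof.
move=> dg; rewrite [g]symalg_sum linear_sum mulr_sumr -sumrB.
apply: ltdeg_sum => m mg _; rewrite linearZ -scalerAr -scalerBr zsM.
apply: ltdegZ; rewrite /= /rhoi slextU.
exact: ltdegW (ltdeg_ssupp dg mg) (actS i (leqnn _)).2.
Qed.

Lemma rho_low x d g : ltdeg d g -> ltdeg d (rho x g - zlin x * g).
Proof.
move=> dg; rewrite /rho /zlin /= !lextE mulr_suml -sumrB.
apply: ltdeg_sum => i _ _; rewrite -scalerAl -scalerBr.
exact/ltdegZ/rhoi_low.
Qed.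

Lemma rhoi_le i m : all (le i) (cseq m) -> rhoi i (zs m) = zs (mmul (ucm i) m).
Proof.
rewrite /rhoi slextU; case: (mdeg m) => [|n] //=.
by case: (cseq m) => [|j s] //= /andP[->].
Qed.

Lemma cseqM_le i m : all (le i) (cseq m) -> cseq (mmul (ucm i) m) = i :: cseq m.
Proof.
move=> im; rewrite -(monK le_total le_trans le_anti (s := i :: _)).
  by rewrite mon_cons cseqK.
by rewrite /= path_sortedE // im cseq_sorted.
Qed.

(** This is the recursion of [act] without fuel. The leading term need no longer be set apart: $j$
    is at most every letter of $z_iz_m$, so it acts there by multiplication. *)
Lemma rhoi_gt i j m : ~~ le i j -> all (le j) (cseq m) ->
  rhoi i (zs (mmul (ucm j) m)) =
  rhoi j (rhoi i (zs m)) + rho (br (e i) (e j)) (zs m).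
Proof.
move=> /negPf ij jm; rewrite {1}/rhoi slextU mdegM mdegU /= cseqM_le // ij.
have dm : (mdeg (mon (cseq m)) <= mdeg m)%N by rewrite cseqK.
rewrite !cseqK.
have -> : rho (br (e i) (e j)) (zs m) =
    lext (fun c => act (mdeg m) c m) (cof (br (e i) (e j))).
  by rewrite /rho !lextE; apply: eq_bigr => c _; rewrite /rhoi slextU.
have [_ low] := actS i (leqnn (mdeg m)).
have -> : slext (act (mdeg m) j) (act (mdeg m) i m - zs (mmul (ucm i) m)) =
    rhoi j (rhoi i (zs m) - zs (mmul (ucm i) m)).
  rewrite {2}/rhoi slextU; apply: eq_ltdeg_linear low => m' m'm.
  by rewrite /= /rhoi !slextU actW.
have jim : all (le j) (cseq (mmul (ucm i) m)).
  rewrite (perm_all _ (perm_cseqM le i m)) /= jm andbT.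
  by have := le_total i j; rewrite ij.
rewrite linearB /= (rhoi_le jim) mulmA (mulmC (ucm i)) -mulmA.
by rewrite [_ + (_ - _)]addrC subrK.
Qed.

Lemma rep_basis g :
  (forall i j, rhoi i (rhoi j g) - rhoi j (rhoi i g) = rho (br (e i) (e j)) g) ->
  forall x y, rho x (rho y g) - rho y (rho x g) = rho (br x y) g.
Proof.
move=> gP x y.
pose f1 y x := rho x (rho y g) - rho y (rho x g); pose f2 y x := rho (br x y) g.
have f1l y' : linear (f1 y').
  by move=> a u v; rewrite /f1 !rho_linl linearP scalerBr opprD addrACA.
have f2l y' : linear (f2 y').
  by move=> a u v; rewrite /f2 br_linl rho_linl.
rewrite -[LHS]/(f1 y x) -[RHS]/(f2 y x).
apply: linear_basis_eq => // i; move: y.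
apply: linear_basis_eq.
- by move=> a u v; rewrite /f1 !rho_linl linearP scalerBr opprD addrACA.
- by move=> a u v; rewrite /f2 br_linr rho_linl.
by move=> j; rewrite /f1 /f2 !rho_e.
Qed.

Lemma rho_br_e_opp i j g : rho (br (e i) (e j)) g = - rho (br (e j) (e i)) g.
Proof.
by rewrite -rhoNl -br_anti.
Qed.

Lemma rep_add i j g1 g2 :
  rhoi i (rhoi j g1) - rhoi j (rhoi i g1) = rho (br (e i) (e j)) g1 ->
  rhoi i (rhoi j g2) - rhoi j (rhoi i g2) = rho (br (e i) (e j)) g2 ->
  rhoi i (rhoi j (g1 + g2)) - rhoi j (rhoi i (g1 + g2)) =
  rho (br (e i) (e j)) (g1 + g2).
Proof.
by move=> C1 C2; rewrite [RHS]linearD /= -C1 -C2 !linearD /= addrACA.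
Qed.

Lemma rep_gt i j m : ~~ le i j -> all (le j) (cseq m) ->
  rhoi i (rhoi j (zs m)) - rhoi j (rhoi i (zs m)) = rho (br (e i) (e j)) (zs m).
Proof.
move=> ij jm; rewrite (rhoi_le jm); set A := rhoi j _.
by rewrite (rhoi_gt ij jm) addrC addKr.
Qed.

Lemma rep_ltdeg n :
  (forall m, (mdeg m < n)%N -> forall i j,
    rhoi i (rhoi j (zs m)) - rhoi j (rhoi i (zs m)) =
    rho (br (e i) (e j)) (zs m)) ->
  forall g, ltdeg n g -> forall x y,
    rho x (rho y g) - rho y (rho x g) = rho (br x y) g.
Proof.
move=> IHn g ng; apply: rep_basis => i j.
pose f1 := (rhoi i \o rhoi j) \- (rhoi j \o rhoi i).
rewrite -[LHS]/(f1 g); apply: (eq_ltdeg_linear _ ng) => m md /=.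
exact: IHn.
Qed.

(** Induction on the degree of a monomial, with $i>j$. If $j$ is at most its least letter $l$, the
    relation is the defining recursion. Otherwise $l$ lies below both $i$ and $j$; pulling $x_l$ to
    the front reduces the claim to lower degree and the Jacobi identity. *)
Lemma rho_rep x y g : rho x (rho y g) - rho y (rho x g) = rho (br x y) g.
Proof.
have [n ng] := ltdeg_exists g; apply: (rep_ltdeg _ ng) => {g ng x y}.
elim: n => // n IHn m; rewrite ltnS leq_eqVlt => /predU1P[dm|/IHn //] i j.
have IH := rep_ltdeg IHn; have swap i' j' :
    rhoi i' (rhoi j' (zs m)) - rhoi j' (rhoi i' (zs m)) =
    rho (br (e i') (e j')) (zs m) ->
    rhoi j' (rhoi i' (zs m)) - rhoi i' (rhoi j' (zs m)) =
    rho (br (e j') (e i')) (zs m).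
  by move=> H; rewrite (rho_br_e_opp j' i') -H opprB.
wlog ij : i j / ~~ le i j => [gt|].
  have [ij|ij] := boolP (le i j); last exact: gt.
  have [ji|ji] := boolP (le j i); last exact/swap/gt.
  have -> : i = j by apply: le_anti; rewrite ij.
  by rewrite br_alt subrr /rho linear0 linear0.
case cm: (cseq m) => [|l s]; first by apply: rep_gt; rewrite // cm.
have [mE dmE s_sorted ls] := cseq_cons cm.
have [jl|jl] := boolP (le j l).
  apply: rep_gt => //; rewrite cm /= jl /=.
  by apply/allP=> a /(allP ls); apply: le_trans.
have il : ~~ le i l.
  apply: contra ij => il; apply: (le_trans il).
  by have := le_total j l; rewrite (negPf jl).
set M := mon s in mE; have cM : cseq M = s by apply: monK.
have dM : mdeg M = n.-1 /\ (0 < n)%N by rewrite -dm dmE mdeg_mon.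
have lowM : ltdeg n (zs M : S) by apply: ltdegU; rewrite dM.1 prednK ?dM.2.
have lM : all (le l) (cseq M) by rewrite cM.
have zmE : zs m = rhoi l (zs M) by rewrite (rhoi_le lM) -mE.
(* The two middle terms are exchanged by swapping $i'$ and $j'$, hence cancel in the commutator. *)
have key i' j' : ~~ le i' l -> ~~ le j' l ->
    rhoi i' (rhoi j' (zs m)) = rhoi l (rhoi i' (rhoi j' (zs M)))
    + rho (br (e i') (e l)) (rhoi j' (zs M))
    + rho (br (e j') (e l)) (rhoi i' (zs M))
    + rho (br (e i') (br (e j') (e l))) (zs M).
  move=> i'l j'l.
  have -> : rhoi j' (zs m) = rhoi l (rhoi j' (zs M)) + rho (br (e j') (e l)) (zs M).
    by rewrite -(rep_gt j'l lM) -zmE subrKC.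
  (* The vector $x_{j'}z_M$ may have degree $n$, out of reach of the induction. Its leading monomial
     $z_{j'}z_M$ is covered by [rep_gt], as $l$ is at most all its letters, and the rest has lower
     degree. *)
  have C1 : rhoi i' (rhoi l (rhoi j' (zs M))) =
      rhoi l (rhoi i' (rhoi j' (zs M))) + rho (br (e i') (e l)) (rhoi j' (zs M)).
    apply/eqP; rewrite addrC -subr_eq; apply/eqP.
    rewrite -[rhoi j' _](subrK (zs (mmul (ucm j') M))).
    apply: rep_add; last first.
      apply: rep_gt => //; rewrite (perm_all _ (perm_cseqM le j' M)) /= lM andbT.
      by have := le_total j' l; rewrite (negPf j'l).
    rewrite -!rho_e; apply: IH; rewrite rho_e -zsM.
    exact: rhoi_low lowM.
  have C2 := IH _ lowM (e i') (br (e j') (e l)).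
  rewrite !rho_e in C2.
  by rewrite linearD /= C1 -C2 -!addrA subrKC.
have C3 := congr1 (rhoi l) (IH _ lowM (e i) (e j)).
rewrite !rho_e linearB /= in C3.
have C4 := IH _ lowM (e l) (br (e i) (e j)); rewrite !rho_e in C4.
have C5 : rho (br (e l) (br (e i) (e j))) (zs M) =
    rho (br (e j) (br (e i) (e l))) (zs M) - rho (br (e i) (br (e j) (e l))) (zs M).
  have := br_jacobi (e l) (e i) (e j); rewrite -addrA => /addr0_eq E.
  rewrite -[br (e l) _]opprK E opprD -(brNr (e j)) -br_anti addrC.
  by rewrite rhoDl rhoNl.
have C6 : rho (br (e i) (e j)) (rhoi l (zs M)) =
    rhoi l (rho (br (e i) (e j)) (zs M)) - rho (br (e l) (br (e i) (e j))) (zs M).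
  by rewrite -C4 opprB addrC subrK.
have sumE (a1 a2 b c r1 r2 : S) :
    a1 + b + c + r1 - (a2 + c + b + r2) = a1 - a2 - (r2 - r1).
  rewrite -(addrA a1) -(addrA a2) (addrC c) (addrAC a1) (addrAC a2).
  by rewrite [a2 + r2 + _]addrC addrKA opprB opprD addrACA.
by rewrite (key i j) // (key j i) // zmE C6 -C3 C5 sumE.
Qed.

Lemma cseq1 : cseq mone = [::].
Proof. by apply: size0nil; rewrite size_cseq mdeg1. Qed.

(** * Universality of the action on polynomials *)

Section Intertwiner.
Variables (V : lmodType k) (tau : L -> V -> V).
Hypothesis tau_linl : forall v, linear (tau^~ v).
Hypothesis tau_linr : forall x, linear (tau x).
Hypothesis tau_rep :
  forall x y v, tau x (tau y v) - tau y (tau x v) = tau (br x y) v.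
Implicit Types (v : V).

Definition word s v := foldr (fun i => tau (e i)) v s.
Definition Psi v : S -> V := slext (fun m => word (cseq m) v).
HB.instance Definition _ v := GRing.Linear.on (Psi v).

Lemma Psi_le v i m : all (le i) (cseq m) ->
  Psi v (zs (mmul (ucm i) m)) = tau (e i) (Psi v (zs m)).
Proof. by move=> im; rewrite /Psi !slextU cseqM_le. Qed.

(** Thus $S$ is the free cyclic module: any vector $v$ of a representation is the image of $1$. The
    proof follows the recursion of the action by induction on the degree, [tau_rep] mirroring the
    exchange of two letters. *)
Lemma Psi_rho v x g : Psi v (rho x g) = tau x (Psi v g).
Proof.
have basis h : (forall i, Psi v (rhoi i h) = tau (e i) (Psi v h)) ->
    forall x, Psi v (rho x h) = tau x (Psi v h).
  move=> hP; apply: (linear_basis_eq (f1 := fun x => Psi v (rho x h))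
      (f2 := tau^~ (Psi v h))) => [a y z||i]; last by rewrite rho_e.
    by rewrite rho_linl linearP.
  exact: tau_linl.
pose tauL y : {linear V -> V} :=
  HB.pack (tau y) (GRing.isLinear.Build k _ _ _ (tau y) (tau_linr y)).
apply: (basis g) => i; have [n ng] := ltdeg_exists g.
pose f1 i := Psi v \o rhoi i; pose f2 i := tauL (e i) \o Psi v.
suff IH m : (mdeg m < n)%N -> forall i, f1 i (zs m) = f2 i (zs m).
  by apply: (eq_ltdeg_linear (f1 := f1 i) (f2 := f2 i)) ng => m md; apply: IH.
elim: n {g ng i} m => // n IHn m; rewrite ltnS leq_eqVlt => /predU1P[dm|/IHn //] i.
rewrite /f1 /f2 /=.
case cm: (cseq m) => [|j s].
  by rewrite rhoi_le ?cm // Psi_le ?cm.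
have [mE dmE s_sorted js] := cseq_cons cm.
have [ij|ij] := boolP (le i j).
  have im : all (le i) (cseq m).
    by rewrite cm /= ij; apply/allP=> a /(allP js); apply: le_trans.
  by rewrite rhoi_le // Psi_le.
set M := mon s in mE; have cM : cseq M = s by apply: monK.
have jM : all (le j) (cseq M) by rewrite cM.
have dM : (mdeg M < n)%N by rewrite mdeg_mon -dm dmE.
have lowM : ltdeg n (zs M : S) by apply: ltdegU.
have C1 l : Psi v (rhoi l (zs M)) = tau (e l) (Psi v (zs M)) := IHn M dM l.
have C2 : Psi v (rhoi j (rhoi i (zs M))) = tau (e j) (tau (e i) (Psi v (zs M))).
  have low : ltdeg n (rhoi i (zs M) - zs (mmul (ucm i) M)).
    by rewrite -zsM; apply: rhoi_low.
  have jiM : all (le j) (cseq (mmul (ucm i) M)).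
    rewrite (perm_all _ (perm_cseqM le i M)) /= jM andbT.
    by have := le_total i j; rewrite (negPf ij).
  have := eq_ltdeg_linear (f1 := f1 j) (f2 := f2 j) (fun m md => IHn m md j) low.
  rewrite (linearB (f1 j)) (linearB (f2 j)) /f1 /f2 /=.
  by rewrite (rhoi_le jiM) (Psi_le _ jiM) C1 => /addIr.
rewrite mE (rhoi_gt ij jM) linearD /= C2 (basis _ C1) Psi_le //.
by rewrite -tau_rep subrKC.
Qed.

End Intertwiner.

(** * The associative product on polynomials *)

Section Env.

Lemma Psi_linr (V : lmodType k) (tau : L -> V -> V) :
  (forall x, linear (tau x)) -> forall g, linear (fun v => Psi tau v g).
Proof.
move=> tau_linr g a u v; rewrite /Psi !slextE scaler_sumr -big_split /=.
apply: eq_bigr => m _; rewrite scalerA mulrC -scalerA -scalerDr; congr (_ *: _).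
by elim: (cseq m) => //= i s ->; rewrite tau_linr.
Qed.

(** The product of $U(L)$ transported to $S$: right multiplication by $g$ is the module endomorphism
    that sends $1$ to $g$. *)
Definition env_mul (f g : S) : S := Psi rho g f.

Lemma env_mul_rho x f g : env_mul (rho x f) g = rho x (env_mul f g).
Proof. exact: (Psi_rho rho_linl rho_is_linear rho_rep). Qed.

Lemma env_mulDl : left_distributive env_mul +%R.
Proof. by move=> f g h; rewrite /env_mul linearD. Qed.

Lemma env_mulDr : right_distributive env_mul +%R.
Proof.
by move=> f g h; have := Psi_linr rho_is_linear f 1 g h; rewrite !scale1r.
Qed.

Lemma env_scaleAl a f g : a *: env_mul f g = env_mul (a *: f) g.
Proof. by rewrite /env_mul linearZ. Qed.

Lemma env_scaleAr a f g : a *: env_mul f g = env_mul f (a *: g).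
Proof.
pose F : {linear S -> S} := HB.pack (fun v => Psi rho v f)
  (GRing.isLinear.Build k S S _ _ (Psi_linr rho_is_linear f)).
by rewrite -[RHS]/(F (a *: g)) linearZ.
Qed.

Lemma env_mul1 : left_id (zs mone) env_mul.
Proof.
by move=> g; rewrite /env_mul /Psi slextU cseq1.
Qed.

Lemma word_rho s : sorted le s -> word rho s (zs mone) = zs (mon s).
Proof.
elim: s => [|i s IHs] /=; first by rewrite /mon big_nil.
rewrite path_sortedE // => /andP[i_min s_sorted].
by rewrite IHs // rho_e rhoi_le ?mon_cons // monK.
Qed.

Lemma env_1mul : right_id (zs mone) env_mul.
Proof.
move=> f; rewrite /env_mul -[RHS]/(idfun f).
apply: (linear_symalg_eq (f1 := Psi rho (zs mone)) (f2 := idfun)) => m.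
by rewrite /= /Psi slextU word_rho ?cseqK // cseq_sorted.
Qed.

Lemma env_mulA : associative env_mul.
Proof.
move=> f g h; have linP u : linear (fun f => env_mul f u).
  by move=> a v w; rewrite /env_mul linearP.
pose R u : {linear S -> S} :=
  HB.pack (fun f => env_mul f u) (GRing.isLinear.Build k _ _ _ _ (linP u)).
rewrite -[LHS]/(R (env_mul g h) f) -[RHS]/((R h \o R g) f).
apply: linear_symalg_eq => m /=; rewrite /env_mul /Psi !slextU.
rewrite -/(Psi rho h g) -[slext _ _]/(env_mul (word rho (cseq m) g) h).
by elim: (cseq m) => //= i s ->; rewrite env_mul_rho.
Qed.

Lemma env_1neq0 : zs mone != 0 :> S.
Proof.
exact: zs1_neq0.
Qed.

Local Notation E := (env_space k I).
Let ring_mixin := GRing.Zmodule_isNzRing.Build E env_mulA env_mul1 env_1mul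
  env_mulDl env_mulDr env_1neq0.
Let ring : nzRingType := HB.pack E ring_mixin.
Let lalg_mixin := GRing.Lmodule_isLalgebra.Build k ring env_scaleAl.
Let lalg : lalgType k := HB.pack E ring_mixin lalg_mixin.
Let alg_mixin := GRing.Lalgebra_isAlgebra.Build k lalg env_scaleAr.
Definition env : algType k := HB.pack E ring_mixin lalg_mixin alg_mixin.

End Env.

(** * Comparison with a given enveloping algebra *)

Section Enveloping.
Variables (U : algType k) (iota : L -> U).
Hypothesis envU : is_enveloping br iota.

Definition pbw_mon m : U := \prod_(i <- cseq m) iota (e i).

(** The universal property maps $U$ to [env], and [Psi] maps back, sending $1$ to $1$. The composite
    $U\to S\to U$ is a ring morphism fixing [iota], hence the identity. The last clause says this;
    it contains both the injectivity of [theta] and the spanning of $U$ by ordered monomials. *)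
Theorem pbw : exists theta : {linear U -> S},
  [/\ theta 1 = zs mone,
      forall x u, theta (iota x * u) = rho x (theta u)
    & forall u, u = slext pbw_mon (theta u)].
Proof.
have [[iota_lin iota_br] univ] := envU.
pose zeta x : env := rho x (zs mone).
have zetaM x (g : env) : zeta x * g = rho x (g : S).
  by rewrite -[LHS]/(env_mul (zeta x) g) env_mul_rho (env_mul1 (g : env_space k I)).
have zeta_lie : lie_morphism br zeta.
  split=> [a x y|x y]; first exact: rho_linl.
  by rewrite !zetaM; symmetry; apply: (rho_rep x y).
have [phi [phiE _]] := univ env zeta zeta_lie.
pose tau x (u : U) := iota x * u.
have tau_linl v : linear (tau^~ v).
  by move=> a x y; rewrite /tau iota_lin mulrDl scalerAl.
have tau_linr x : linear (tau x).
  by move=> a u v; rewrite /tau mulrDr scalerAr.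
have tau_rep x y v : tau x (tau y v) - tau y (tau x v) = tau (br x y) v.
  by rewrite /tau !mulrA -mulrBl -iota_br.
have wordE s v : word tau s v = (\prod_(i <- s) iota (e i)) * v.
  by elim: s => [|i s IHs] /=; rewrite ?big_nil ?mul1r // big_cons IHs -mulrA.
pose psi : S -> U := Psi tau 1.
have psi_rho x g : psi (rho x g) = iota x * psi g by exact: Psi_rho.
have psi_mul f g : psi (env_mul f g) = psi f * psi g.
  have linL : linear (fun f => psi (env_mul f g)).
    by move=> a u v; rewrite /psi /env_mul !linearP.
  have linR : linear (fun f => psi f * psi g).
    by move=> a u v; rewrite /psi linearP mulrDl scalerAl.
  pose FL : {linear S -> U} := HB.pack (fun f => psi (env_mul f g))
    (GRing.isLinear.Build k _ _ _ _ linL).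
  pose FR : {linear S -> U} := HB.pack (fun f => psi f * psi g)
    (GRing.isLinear.Build k _ _ _ _ linR).
  rewrite -[LHS]/(FL f) -[RHS]/(FR f); apply: linear_symalg_eq => m /=.
  rewrite /env_mul {1}/Psi slextU {2}/psi /Psi slextU wordE mulr1 -/(Psi tau 1).
  elim: (cseq m) => [|i s IHs] /=; first by rewrite big_nil mul1r.
  by rewrite psi_rho IHs big_cons mulrA.
have psi_1 : psi (zs mone) = 1 by rewrite /psi /Psi slextU cseq1.
have psi_lin : linear psi by move=> a u v; rewrite /psi linearP.
pose Psi' : {lrmorphism env -> U} := HB.pack (psi : env -> U)
  (GRing.isLinear.Build k env U _ (psi : env -> U) psi_lin)
  (GRing.isMonoidMorphism.Build env U (psi : env -> U) (psi_1, psi_mul)).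
have phi_lin : linear (phi : U -> S) by move=> a u v; rewrite linearP.
pose theta : {linear U -> S} :=
  HB.pack (phi : U -> S) (GRing.isLinear.Build k U S _ _ phi_lin).
exists theta.
split=> [|x u|u] /=; first exact: (rmorph1 phi).
  by rewrite -zetaM -phiE; apply: (rmorphM phi).
have [id' [_ uniq]] := univ U iota (conj iota_lin iota_br).
have psi_phi : psi \o phi =1 id'.
  apply: (uniq (Psi' \o phi)) => x /=; rewrite phiE /zeta psi_rho.
  by rewrite psi_1 mulr1.
have id_id : id =1 id' by exact: (uniq idfun).
rewrite {1}[u]id_id -psi_phi /= /psi /Psi !slextE; apply: eq_bigr => m _.
by rewrite wordE mulr1.
Qed.

End Enveloping.
(** * Symbols of central elements *)

(** The derivation $\sum_i\delta_i\,\partial/\partial z_i$; exponents arise because a repeated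
    letter is summed repeatedly. *)
Definition Der (delta : I -> S) : S -> S :=
  slext (fun m => \sum_(i <- cseq m) delta i * zs (divcm m (ucm i))).
HB.instance Definition _ delta := GRing.Linear.on (Der delta).

Lemma divcmMl i m : divcm (mmul (ucm i) m) (ucm i) = m.
Proof. by apply/eqP/cmP=> j; rewrite divcmE cmM addKn. Qed.

Lemma divcmMr i j m : i \in cseq m ->
  divcm (mmul (ucm j) m) (ucm i) = mmul (ucm j) (divcm m (ucm i)).
Proof.
rewrite mem_cseq => mi; apply/eqP/cmP=> l; rewrite divcmE !cmM divcmE addnBA //.
by rewrite cmU; case: eqVneq => // <-; rewrite lt0n.
Qed.

Lemma big_cseqM (V : zmodType) (F : I -> V) j m :
  \sum_(i <- cseq (mmul (ucm j) m)) F i = F j + \sum_(i <- cseq m) F i.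
Proof. by rewrite (perm_big _ (perm_cseqM le j m)) big_cons. Qed.

Lemma DerM delta j g :
  Der delta (zs (ucm j) * g) = delta j * g + zs (ucm j) * Der delta g.
Proof.
pose mulL (f : S) : {linear S -> S} := HB.pack ( *%R f)
  (GRing.isLinear.Build k S S _ ( *%R f)
    (fun a u v => etrans (mulrDr f _ _) (congr1 (+%R^~ _) (esym (scalerAr a f u))))).
rewrite -[LHS]/((Der delta \o mulL (zs (ucm j))) g).
rewrite -[RHS]/((mulL (delta j) \+ (mulL (zs (ucm j)) \o Der delta)) g).
apply: linear_symalg_eq => m /=; rewrite zsM /Der !slextU big_cseqM divcmMl.
rewrite mulr_sumr; congr (_ + _); apply: eq_big_seq => i im.
by rewrite divcmMr // mulrCA zsM.
Qed.

Lemma mdeg_divcm i m : i \in cseq m -> mdeg m = (mdeg (divcm m (ucm i))).+1.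
Proof.
move=> im; rewrite -{1}(divcmMl i m) divcmMr // mdegM mdegU.
by rewrite add1n.
Qed.

Lemma Der_ltdeg delta d g :
  (forall i, ltdeg 2 (delta i)) -> ltdeg d g -> ltdeg d (Der delta g).
Proof.
move=> delta2; apply: ltdeg_slext => m md; apply: ltdeg_sum => i im _.
apply: (@ltdegW _ _ (1 + mdeg m)); first by rewrite add1n.
by apply: ltdegM => //; apply: ltdegU; rewrite [mdeg m](mdeg_divcm im).
Qed.

Lemma zlin_ltdeg x : ltdeg 2 (zlin x).
Proof.
rewrite /zlin /= lextE; apply: ltdeg_sum => i _ _.
by apply/ltdegZ/ltdegU; rewrite mdegU.
Qed.

Lemma zlin_e i : zlin (e i) = zs (ucm i).
Proof. by rewrite /zlin /= cofe lextU. Qed.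

(* The Poisson action of [x] on the symmetric algebra. *)
Definition Dlie x : S -> S := Der (fun i => zlin (br x (e i))).
HB.instance Definition _ x := GRing.Linear.on (Dlie x).

Lemma Dlie_ltdeg x d g : ltdeg d g -> ltdeg d (Dlie x g).
Proof. by apply: Der_ltdeg => i; apply: zlin_ltdeg. Qed.

Section Symbol.
Variables (U : algType k) (iota : L -> U) (theta : {linear U -> S}).
Hypothesis iota_lie : lie_morphism br iota.
Hypothesis theta1 : theta 1 = zs mone.
Hypothesis thetaM : forall x u, theta (iota x * u) = rho x (theta u).
Hypothesis thetaK : forall u, u = slext (pbw_mon iota) (theta u).

Lemma theta_low x d u : ltdeg d (theta u) ->
  ltdeg d (theta (iota x * u) - zlin x * theta u).
Proof. by rewrite thetaM; apply: rho_low. Qed.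

Lemma theta_iotaM x d u : ltdeg d (theta u) -> ltdeg d.+1 (theta (iota x * u)).
Proof.
move=> du; rewrite -[theta _](subrK (zlin x * theta u)); apply: ltdegD.
  exact: ltdegW (leqnSn d) (theta_low x du).
by rewrite -add1n; apply: ltdegM => //; apply: zlin_ltdeg.
Qed.

Lemma theta_prod_ltdeg s : ltdeg (size s).+1 (theta (\prod_(i <- s) iota (e i))).
Proof.
elim: s => [|i s IHs]; last by rewrite big_cons; apply: theta_iotaM.
by rewrite big_nil theta1; apply: ltdegU; rewrite mdeg1.
Qed.

(** Induction along the word: the commutator with $x$ and [Dlie x] obey the same Leibniz rule, and
    replacing the action of a letter by multiplication costs only lower degree. *)
Lemma symbol_comm_prod x s : let u := \prod_(i <- s) iota (e i) in
  ltdeg (size s) (theta (iota x * u - u * iota x) - Dlie x (theta u)).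
Proof.
elim: s => [|a s IHs] u.
  rewrite /u big_nil mul1r mulr1 subrr linear0 theta1 /Dlie /Der slextU.
  by rewrite cseq1 big_nil subrr; apply: ltdeg0.
rewrite {}/u big_cons; set u := \prod_(i <- s) _ in IHs *.
have du : ltdeg (size s).+1 (theta u) by apply: theta_prod_ltdeg.
set c := iota x * u - u * iota x in IHs.
have -> : iota x * (iota (e a) * u) - iota (e a) * u * iota x =
    iota (br x (e a)) * u + iota (e a) * c.
  by rewrite iota_lie.2 /c mulrBl mulrBr !mulrA addrA subrK.
have dc : ltdeg (size s).+1 (theta c).
  rewrite -[theta c](subrK (Dlie x (theta u))).
  by apply: ltdegD; [apply: ltdegW (leqnSn _) IHs | apply: Dlie_ltdeg].
(* [E1] to [E4] are the errors made in turning the Leibniz rule of $U$ into that of $S$; each has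
   degree at most the length of $s$, and together they telescope to the claim. *)
have E1 := theta_low (br x (e a)) du.
have E2 := theta_low (e a) dc.
have E3 : ltdeg (size s).+1 (zlin (e a) * (theta c - Dlie x (theta u))).
  by rewrite -add1n; apply: ltdegM => //; apply: zlin_ltdeg.
have E4 := Dlie_ltdeg x (theta_low (e a) du).
have := ltdegB (ltdegD (ltdegD E1 E2) E3) E4.
have -> : Dlie x (theta (iota (e a) * u) - zlin (e a) * theta u) =
   Dlie x (theta (iota (e a) * u)) - zlin (br x (e a)) * theta u
     - zlin (e a) * Dlie x (theta u).
  by rewrite linearB /= zlin_e [Dlie x (_ * _)]DerM opprD addrA.
clearbody c; rewrite mulrBr (linearD theta) /=.
set A := theta (_ * u); set B := theta (_ * c); set C := Dlie x (theta (_ * u)).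
set P := zlin _ * theta u; set Q := zlin _ * theta c; set R := zlin _ * Dlie _ _.
suff -> : A - P + (B - Q) + (Q - R) - (C - P - R) = A + B - C by [].
by rewrite -(addrA (A - P)) subrKA addrACA -!opprD -(addrA C) -opprD opprB subrKA.
Qed.

Lemma symbol_comm x d u : ltdeg d.+1 (theta u) ->
  ltdeg d (theta (iota x * u - u * iota x) - Dlie x (theta u)).
Proof.
move=> du; pose f v := theta (iota x * v - v * iota x) - Dlie x (theta v).
have lin_f : linear f.
  move=> a v w; rewrite /f mulrDr mulrDl -scalerAr -scalerAl opprD addrACA -scalerBr.
  by rewrite !(linearP theta) (linearP (Dlie x)) /= opprD addrACA -scalerBr.
pose F : {linear U -> S} := HB.pack f (GRing.isLinear.Build k U S _ f lin_f).
rewrite -[_ - _]/(F u) (thetaK u) slextE linear_sum; apply: ltdeg_sum => m mu _.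
rewrite linearZ; apply: ltdegZ; have := @symbol_comm_prod x (cseq m).
rewrite size_cseq; apply: ltdegW.
exact: ltdeg_ssupp du mu.
Qed.

Lemma central_Dlie x d u : ltdeg d.+1 (theta u) -> central u ->
  ltdeg d (Dlie x (theta u)).
Proof.
move=> du cu; have := symbol_comm x du.
by rewrite cu subrr linear0 sub0r => /ltdegN; rewrite opprK.
Qed.

End Symbol.

(* The sum over [i] of [d f / d z_i] at the coefficient of [M], times [h i].  *)
Definition polar (V : lmodType k) (f : S) (M : {cmonom I}) (h : I -> V) : V :=
  \sum_(m <- ssupp f) \sum_(i <- cseq m | m == mmul (ucm i) M) scoef m f *: h i.

(** As $z_t$ divides neither $m$ nor $M$, it must come from the linear factor. *)
Lemma zlin_mulX_coef x t m (M : {cmonom I}) : m t = 0%N -> M t = 0%N ->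
  scoef (mmul (ucm t) M) (zlin x * zs m) = (cof x)@_t *+ (m == M).
Proof.
move=> mt Mt; rewrite /zlin /= lextE mulr_suml scoef_sum.
rewrite {3}[cof x]malg_sum raddf_sum /= -sumrMnl; apply: eq_bigr => c _.
rewrite -scalerAl zsM scoefZ mcoeffZ scoef_zs mcoeff_zm -mulrnAr; congr (_ * _).
rewrite -mulrnA mulnb; congr (_%:R); congr nat_of_bool.
apply/eqP/andP => [E|[/eqP-> /eqP->]] //.
have /(congr1 (fun m : {cmonom I} => m t)) := E; rewrite !cmM mt Mt !addn0 cmU cmUU.
case: eqVneq => // ct _; rewrite ct in E; split=> //.
by rewrite -(divcmMl t m) E divcmMl.
Qed.

(** In $\{x,f\}=\sum_i[x,e_i]\,\partial f/\partial z_i$ a variable absent from $f$ can only come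
    from a bracket $[x,e_i]$. *)
Lemma Dlie_coef x t (f : S) (M : {cmonom I}) :
  M t = 0%N -> (forall m, m \in ssupp f -> m t = 0%N) ->
  scoef (mmul (ucm t) M) (Dlie x f) =
  polar f M (fun i => (cof (br x (e i)))@_t : k^o).
Proof.
move=> Mt ft; rewrite /Dlie /Der slextE scoef_sum /polar.
rewrite big_seq [RHS]big_seq; apply: eq_bigr => m mf.
rewrite scoefZ scoef_sum mulr_sumr [RHS]big_mkcond /=.
rewrite big_seq [RHS]big_seq; apply: eq_bigr => i im.
rewrite zlin_mulX_coef //; last by rewrite divcmE ft.
have -> : (divcm m (ucm i) == M) = (m == mmul (ucm i) M).
  apply/eqP/eqP => [<-|->]; last exact: divcmMl.
  by rewrite -divcmMr // divcmMl.
by case: eqP; rewrite ?mulr0.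
Qed.

(** The exponent produced by differentiation; in characteristic $p$ it detects divisibility by
    $p$. *)
Lemma polar_delta f M j :
  polar f M (fun i => (i == j)%:R : k^o) =
  scoef (mmul (ucm j) M) f *+ (mmul (ucm j) M) j.
Proof.
have [fM|fM] := boolP (mmul (ucm j) M \in ssupp f); last first.
  rewrite -scoef_neq0 negbK in fM; rewrite (eqP fM) mul0rn /polar.
  rewrite big1_seq // => m /= mf; rewrite big1 // => i /eqP mM.
  case: eqP => [ij|_]; last by rewrite scaler0.
  by rewrite mM ij (eqP fM) scale0r.
rewrite /polar (bigD1_seq _ fM (ssupp_uniq f)) /= [X in _ + X]big1 ?addr0.
  rewrite -(count_cseq le) -sum1_count [in RHS]big_mkcond -sumrMnr big_mkcond /=.
  apply: eq_bigr => i _; have [->|_] := eqVneq i j.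
    by rewrite eqxx -[LHS]/(_ * _) mulr1.
  by rewrite scaler0 if_same.
move=> m /negPf mM; apply: big1 => i /eqP mi.
by case: eqP mi => [->|_ _]; [move/eqP; rewrite mM | rewrite scaler0].
Qed.

Lemma eq_polar (V : lmodType k) (f : S) (M : {cmonom I}) (h1 h2 : I -> V) :
  h1 =1 h2 -> polar f M h1 = polar f M h2.
Proof.
by move=> h12; apply: eq_bigr => m _; apply: eq_bigr => i _; rewrite h12.
Qed.

Lemma linear_polar (V W : lmodType k) (phi : {linear V -> W}) f M (h : I -> V) :
  phi (polar f M h) = polar f M (phi \o h).
Proof.
rewrite /polar linear_sum; apply: eq_bigr => m _.
by rewrite linear_sum; apply: eq_bigr => i _; rewrite linearZ.
Qed.

(** * Central elements with symbols the p-th powers *)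

Section PowerCenter.
Variables (U : algType k) (iota : L -> U) (theta : {linear U -> S}).
Hypothesis theta1 : theta 1 = zs mone.
Hypothesis thetaM : forall x u, theta (iota x * u) = rho x (theta u).
Hypothesis thetaK : forall u, u = slext (pbw_mon iota) (theta u).
Variables (p : nat) (lower : I -> L).
Hypothesis p_gt1 : (1 < p)%N.

(** [lower i] stands for the value of the $p$-map at [e i]. For symbols it matters only that it lies
    in $L$, so has degree at most $1<p$. *)
Definition xi i : U := iota (e i) ^+ p - iota (lower i).
Hypothesis xi_central : forall i, central (xi i).

Definition xi_mon m : U := \prod_(i <- cseq m) xi i.

Definition mpow m : {cmonom I} := iter p (mmul m) mone.

Lemma mpowE m i : mpow m i = (p * m i)%N.
Proof.
rewrite /mpow; elim: p => [|q IHq] /=; first by rewrite cm1.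
by rewrite cmM IHq mulSn.
Qed.

Lemma zs_mpow m : zs (mpow m) = zs m ^+ p.
Proof.
rewrite /mpow; elim: p => [|q IHq] /=; first by rewrite expr0 zs1.
by rewrite -zsM IHq exprS.
Qed.

Lemma mdeg_mpow m : mdeg (mpow m) = (p * mdeg m)%N.
Proof.
by rewrite /mpow; elim: p => [|q IHq] /=; rewrite ?mdeg1 // mdegM IHq mulSn.
Qed.

Lemma mpow_inj : injective mpow.
Proof.
move=> m1 m2 E; apply/eqP/cmP=> i; have /eqP := congr1 (fun m : {cmonom I} => m i) E.
by rewrite !mpowE eqn_pmul2l ?(ltnW p_gt1) // => /eqP.
Qed.

Lemma theta_expM x a n u : ltdeg n.+1 (theta u) ->
  ltdeg (n + a) (theta (iota x ^+ a * u) - zlin x ^+ a * theta u).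
Proof.
move=> nu; have du b : ltdeg (n + b).+1 (theta (iota x ^+ b * u)).
  elim: b => [|b IHb]; first by rewrite addn0 expr0 mul1r.
  by rewrite exprS -mulrA addnS; apply: theta_iotaM.
elim: a => [|a IHa]; first by rewrite !expr0 !mul1r subrr; apply: ltdeg0.
rewrite exprS -mulrA exprS -mulrA addnS.
rewrite -[theta _](subrK (zlin x * theta (iota x ^+ a * u))) -addrA -mulrBr.
apply: ltdegD; first by apply: theta_low.
by rewrite -add1n; apply: ltdegM => //; apply: zlin_ltdeg.
Qed.

Lemma theta_xiM i n u : ltdeg n.+1 (theta u) ->
  ltdeg (n + p) (theta (xi i * u) - zs (ucm i) ^+ p * theta u).
Proof.
move=> nu; rewrite /xi mulrBl linearB /= addrAC -zlin_e.
apply: ltdegB; first exact: theta_expM.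
apply: (@ltdegW _ _ n.+2); last exact: theta_iotaM.
by rewrite -addn2 leq_add2l.
Qed.

Lemma theta_xi_mon m : ltdeg (p * mdeg m) (theta (xi_mon m) - zs (mpow m)).
Proof.
rewrite zs_mpow -{3}(cseqK le m) -(size_cseq le m) /xi_mon.
elim: (cseq m) => [|i s IHs].
  rewrite /mon !big_nil theta1 zs1 expr1n subrr; exact: ltdeg0.
rewrite mon_cons -zsM exprMn big_cons /= mulnS addnC.
set u := \prod_(i <- s) xi i in IHs *.
have du : ltdeg (p * size s).+1 (theta u).
  rewrite -[theta u](subrK (zs (mon s) ^+ p)); apply: ltdegD.
    exact: ltdegW (leqnSn _) IHs.
  by rewrite -zs_mpow; apply: ltdegU; rewrite mdeg_mpow mdeg_mon.
rewrite -[theta _](subrK (zs (ucm i) ^+ p * theta u)) -addrA -mulrBr.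
apply: ltdegD; first exact: theta_xiM.
rewrite addnC; apply: ltdegM IHs; rewrite -zs_mpow; apply: ltdegU.
by rewrite mdeg_mpow mdegU muln1.
Qed.

Lemma perm_prod_xi s1 s2 : perm_eq s1 s2 ->
  \prod_(i <- s1) xi i = \prod_(i <- s2) xi i.
Proof.
elim: s1 s2 => [|x s1 IHs] s2.
  by rewrite perm_sym => /perm_nilP->.
move=> s12; have xs2 : x \in s2 by rewrite -(perm_mem s12) mem_head.
case/splitPr: xs2 s12 => a b s12.
have /IHs {}IHs : perm_eq s1 (a ++ b).
  by move: s12; rewrite perm_sym -[x :: b]cat1s perm_catCA /= perm_cons perm_sym.
rewrite big_cons IHs !big_cat big_cons /= mulrA.
by rewrite xi_central !mulrA.
Qed.

Lemma xi_monMu i m : xi_mon (mmul (ucm i) m) = xi i * xi_mon m.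
Proof.
by rewrite /xi_mon (perm_prod_xi (perm_cseqM le i m)) big_cons.
Qed.

Lemma xi_monM m1 m2 : xi_mon (mmul m1 m2) = xi_mon m1 * xi_mon m2.
Proof.
rewrite -(cseqK le m1); elim: (cseq m1) => [|i s IHs].
  by rewrite /mon big_nil mul1m /xi_mon cseq1 big_nil mul1r.
by rewrite mon_cons -mulmA !xi_monMu IHs mulrA.
Qed.

Lemma xi_slextM : {morph slext xi_mon : f g / f * g}.
Proof.
move=> f g; rewrite [f]symalg_sum [g]symalg_sum.
rewrite !linear_sum !mulr_suml linear_sum; apply: eq_bigr => m1 _.
rewrite !mulr_sumr linear_sum; apply: eq_bigr => m2 _.
rewrite -scalerAl -scalerAr !linearZ /= zsM !slextU xi_monM.
by rewrite -scalerAl -scalerAr.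
Qed.

Lemma xi_slext1 : slext xi_mon 1 = 1.
Proof. by rewrite -zs1 slextU /xi_mon cseq1 big_nil. Qed.

Lemma central_xi_slext f : central (slext xi_mon f).
Proof.
move=> v; rewrite slextE mulr_suml mulr_sumr; apply: eq_bigr => m _.
rewrite -scalerAl -scalerAr; congr (_ *: _); rewrite /xi_mon.
elim: (cseq m) => [|i s IHs]; first by rewrite big_nil mul1r mulr1.
by rewrite big_cons -mulrA IHs mulrA xi_central mulrA.
Qed.

Lemma subalgebra_gen_xi_slext (B : U -> Prop) f :
  (forall i, B (xi i)) -> subalgebra_gen B (slext xi_mon f).
Proof.
move=> Bxi; rewrite slextE; apply: big_ind => [|u v|m _].
- by rewrite -(scale0r 1); apply: Gen_scalar.
- exact: Gen_add.
rewrite -[xi_mon m]mul1r scalerAl; apply: Gen_mul; first exact: Gen_scalar.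
rewrite /xi_mon; apply: big_ind => [|u v|i _].
- by rewrite -(scale1r 1); apply: Gen_scalar.
- exact: Gen_mul.
- exact: Gen_in.
Qed.

(** Each [xi_mon] has symbol a $p$-th power, and distinct monomials have distinct $p$-th powers, so
    the top coefficients of $f$ survive unmixed. This is what forces injectivity below. *)
Lemma scoef_theta_xi_slext d f m : ltdeg d.+1 f -> mdeg m = d ->
  scoef (mpow m) (theta (slext xi_mon f)) = scoef m f.
Proof.
move=> df md; rewrite slextE linear_sum scoef_sum [in RHS](symalg_sum f) scoef_sum.
apply: eq_big_seq => m' /(ltdeg_ssupp df); rewrite ltnS -md => m'd.
rewrite linearZ !scoefZ; congr (_ * _).
rewrite -[theta _](subrK (zs (mpow m'))) scoefD !scoef_zs (inj_eq mpow_inj).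
by rewrite theta_xi_mon ?add0r // mdeg_mpow leq_mul2l m'd orbT.
Qed.

Lemma ltdeg0_eq0 (f : S) : ltdeg 0 f -> f = 0.
Proof.
move=> f0; rewrite [f]symalg_sum big1 // => m _.
by rewrite f0 ?scale0r.
Qed.

Lemma xi_slext_inj : injective (slext xi_mon).
Proof.
move=> f g fg; apply/eqP; rewrite -subr_eq0; apply/eqP.
have : slext xi_mon (f - g) = 0 by rewrite linearB /= fg subrr.
move: (f - g) => {fg}f {g} f0; apply: ltdeg0_eq0.
have [n nf] := ltdeg_exists f; elim: n nf => // n IHn nf; apply: IHn => m.
rewrite leq_eqVlt => /predU1P[nm|]; last exact: nf.
by rewrite -(scoef_theta_xi_slext nf (esym nm)) f0 linear0 scoef0.
Qed.

Hypothesis central_top : forall u d m, central u -> ltdeg d.+1 (theta u) ->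
  mdeg m = d -> m \in ssupp (theta u) -> forall i, (p %| m i)%N.

(** The top part of $u$ consists of $p$-th powers of monomials, so it is the symbol of a combination
    of products of the [xi]. Subtracting that combination leaves a central element of lower
    degree. *)
Lemma central_xi_slextP u : central u -> exists f, slext xi_mon f = u.
Proof.
have [n nu] := ltdeg_exists (theta u).
elim: n u nu => [|n IHn] u nu cu.
  by exists 0; rewrite linear0 [u]thetaK (ltdeg0_eq0 nu) linear0.
pose root m : {cmonom I} := [cmonom (m i %/ p)%N | i in finsupp m]%M.
have rootE m i : root m i = (m i %/ p)%N.
  by rewrite /root cmE fsfun_fun; case: mdomP => //; rewrite div0n.
(* The top part of [theta u] with every exponent divided by $p$. *)
pose f := \sum_(m <- ssupp (theta u) | mdeg m == n) scoef m (theta u) *: zs (root m).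
have [||g gE] := IHn (u - slext xi_mon f).
- rewrite linearB /= [X in X - _]symalg_sum (bigID (fun m => mdeg m == n)) /=.
  rewrite addrAC; apply: ltdegD; last first.
    apply: ltdeg_sum => m mu mn; apply/ltdegZ/ltdegU.
    by have := ltdeg_ssupp nu mu; rewrite ltnS leq_eqVlt (negPf mn).
  rewrite /f linear_sum linear_sum.
  rewrite -sumrB; apply: ltdeg_sum => m mu /eqP mn.
  rewrite (linearZ_LR (slext xi_mon)) (linearZ_LR theta) /= slextU -scalerBr.
  apply: ltdegZ.
  rewrite -opprB; apply: ltdegN.
  have mE : mpow (root m) = m.
    apply/eqP/cmP=> i; rewrite mpowE rootE mulnC divnK //.
    exact: (central_top cu nu mn mu).
  by rewrite -{2}mE -mn -{1}mE mdeg_mpow; apply: theta_xi_mon.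
- by move=> v; rewrite mulrBl mulrBr cu central_xi_slext.
by exists (g + f); rewrite linearD /= gE subrK.
Qed.

Theorem xi_freely_generates : freely_generates xi (@central U).
Proof.
have f_lin : linear (slext xi_mon) by move=> a f g; rewrite linearP.
pose phi : {lrmorphism S -> U} := HB.pack (slext xi_mon : S -> U)
  (GRing.isLinear.Build k S U _ (slext xi_mon) f_lin)
  (GRing.isMonoidMorphism.Build S U (slext xi_mon) (xi_slext1, xi_slextM)).
exists (phi \o of_malg); split=> [i|f g|u] /=.
- by rewrite of_malgU slextU -(mulm1 (ucm i)) xi_monMu /xi_mon cseq1 big_nil
    mulr1.
- by move/xi_slext_inj => /(can_inj (@of_malgK k I)).
split=> [/central_xi_slextP[f <-]|[q <-]]; last exact: central_xi_slext.
by exists (to_malg f); rewrite /= to_malgK.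
Qed.

End PowerCenter.

(** * A criterion for the center of an enveloping algebra *)

Section EnvelopingCenter.
Variables (U : algType k) (iota : L -> U).
Hypothesis envU : is_enveloping br iota.

Lemma central_iota z : (forall x, z * iota x = iota x * z) -> central z.
Proof.
have [theta [_ _ thetaK]] := pbw envU.
move=> zx u; rewrite [u]thetaK slextE mulr_suml mulr_sumr; apply: eq_bigr => m _.
rewrite -scalerAl -scalerAr; congr (_ *: _); rewrite /pbw_mon.
elim: (cseq m) => [|i s IHs]; first by rewrite big_nil mul1r mulr1.
by rewrite big_cons mulrA zx -mulrA IHs mulrA.
Qed.

(** What remains to be known of $L$ is the centrality of the [xi] and a statement about polynomials.
    In the latter $M$ has one variable fewer than the top degree $d$ and $t$ is a fresh variable, so
    $z_tM$ is again of degree $d$, where the Poisson bracket vanishes. *)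
Theorem enveloping_center (p : nat) (lower : I -> L) :
  (1 < p)%N -> (forall i, central (xi iota p lower i)) ->
  (forall (f : S) d,
    (forall x t (M : {cmonom I}), (mdeg M).+1 = d -> M t = 0%N ->
       (forall m, m \in ssupp f -> m t = 0%N) ->
       polar f M (fun i => (cof (br x (e i)))@_t : k^o) = 0) ->
    forall m, mdeg m = d -> m \in ssupp f -> forall i, (p %| m i)%N) ->
  freely_generates (xi iota p lower) (@central U) /\
  forall B : U -> Prop, (forall i, B (xi iota p lower i)) ->
    forall z, central z -> subalgebra_gen B z.
Proof.
move=> p_gt1 xi_central polar_dvd.
have [theta [theta1 thetaM thetaK]] := pbw envU.
have top u d m : central u -> ltdeg d.+1 (theta u) ->
    mdeg m = d -> m \in ssupp (theta u) -> forall i, (p %| m i)%N.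
  move=> cu du; apply: polar_dvd => x t M Md Mt ut.
  rewrite -Dlie_coef //; apply: (central_Dlie envU.1 theta1 thetaM thetaK x du cu).
  by rewrite mdegM mdegU add1n Md.
split; first exact: (xi_freely_generates theta1 thetaM thetaK).
move=> B BP z /(central_xi_slextP theta1 thetaM thetaK p_gt1 xi_central top)[f <-].
exact: subalgebra_gen_xi_slext.
Qed.

End EnvelopingCenter.

End PBW.

(** * The current algebra of o_N *)

Section PowerAdjoint.
Variable R : nzRingType.

Definition ad (a v : R) : R := a * v - v * a.

Lemma sum_bin_pascal (V : zmodType) (T : nat -> V) n :
  \sum_(j < n.+2) T j *+ 'C(n.+1, j) = \sum_(j < n.+1) (T j.+1 + T j) *+ 'C(n, j).
Proof.
rewrite (eq_bigr _ (fun (j : 'I_n.+1) _ => mulrnDl _ _ _)) [RHS]big_split /=.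
rewrite big_ord_recl.
under [X in _ + X = _]eq_bigr => j _ do rewrite lift0 binS mulrnDr.
rewrite big_split /= addrA [RHS]addrC; congr (_ + _).
rewrite [RHS]big_ord_recl big_ord_recr /= (bin_small (ltnSn n)) mulr0n addr0 !bin0.
by congr (_ + _); apply: eq_bigr => j _.
Qed.

(** Left multiplication by $a$ is the sum of [ad a] and right multiplication by $a$, which commute:
    this is the binomial theorem for them. *)
Lemma mul_exp_ad (a u : R) n :
  a ^+ n * u =
  \sum_(j < n.+1) (iter j (ad a) u * a ^+ (n - j)) *+ 'C(n, j).
Proof.
elim: n => [|n IHn].
  by rewrite big_ord1 /= !expr0 mulr1 mul1r.
rewrite exprS -mulrA IHn mulr_sumr.
rewrite (sum_bin_pascal (fun j => iter j (ad a) u * a ^+ (n.+1 - j))).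
apply: eq_bigr => j _; rewrite mulrnAr; congr (_ *+ _).
have jn : (j <= n)%N by rewrite -ltnS.
by rewrite subSS subSn // exprS /= {2}/ad mulrBl !mulrA subrK.
Qed.

Lemma iter_ad_pchar p (a u : R) : p \in [pchar R] ->
  iter p (ad a) u = a ^+ p * u - u * a ^+ p.
Proof.
move=> charR; have p_pr := pcharf_prime charR.
case: p p_pr charR => // q p_pr charR.
rewrite mul_exp_ad big_ord_recr big_ord_recl bin0 binn subn0 subnn /=.
rewrite expr0 mulr1 !mulr1n big1 ?addr0; first by rewrite addrC addrK.
move=> j _; rewrite /bump add1n -mulr_natr.
have /dvdnP[c ->] : (q.+1 %| 'C(q.+1, j.+1))%N.
  by apply: prime_dvd_bin => //=; rewrite ltnS ltn_ord.
by rewrite natrM (pcharf0 charR) !mulr0.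
Qed.

End PowerAdjoint.

(** * Lie axioms and coordinates for the current algebra *)

Section OrthogonalBasis.
Variables (k : fieldType) (m : nat).
Local Notation I := (basis_idx m).
Local Notation M := 'M[k]_m.+1.
Local Notation lie := (@lie_oNt k m).
Implicit Types (i j : 'I_m.+1) (r : nat) (x y z : oNt k m) (A : M).

Lemma scalar_polyC_comm (c : k) (P : {poly M}) : P * (c%:M)%:P = c%:M *: P.
Proof.
by apply/polyP=> n; rewrite coefMC coefZ; apply: scalar_mxC.
Qed.

Lemma scale_polyAr (c : k) (P Q : {poly M}) : P * (c%:M *: Q) = c%:M *: (P * Q).
Proof. by rewrite -mul_polyC mulrA scalar_polyC_comm -scalerAl. Qed.

Lemma lie_oNt_alt x : lie x x = 0.
Proof. by apply: val_inj; rewrite /= subrr. Qed.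

Lemma lie_oNt_anti x y : lie x y = - lie y x.
Proof. by apply: val_inj; rewrite /= opprB. Qed.

Lemma lie_oNt_linl y : linear (lie^~ y).
Proof.
move=> c x1 x2; apply: val_inj => /=.
by rewrite mulrDl mulrDr -scalerAl scale_polyAr opprD addrACA -scalerBr.
Qed.

Lemma lie_oNt_linr x : linear (lie x).
Proof.
move=> c y1 y2; rewrite lie_oNt_anti lie_oNt_linl opprD -scalerN.
by rewrite -!(lie_oNt_anti x).
Qed.

Lemma lie_oNt_jacobi x y z :
  lie x (lie y z) + lie y (lie z x) + lie z (lie x y) = 0.
Proof.
apply: val_inj => /=; set X := poly_of_oNt x; set Y := poly_of_oNt y.
set Z := poly_of_oNt z; rewrite !mulrBr !mulrBl !mulrA !opprB.
rewrite !addrA [LHS](ACl ((1*12)*(5*4)*(7*2)*(3*10)*(11*6)*(9*8))) /=.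
by rewrite !subrr !addr0.
Qed.

Lemma oN_anti A i j : A \in oN k m -> A i j = - A (rev_ord j) (rev_ord i).
Proof.
by move=> /oN_sigmaP[z ->]; rewrite !mxE !rev_ordK opprB.
Qed.

(** Reflection in the antidiagonal changes the sign of the entries: those below are determined by
    those above, and those on the antidiagonal equal their own negatives. *)
Lemma oN_eq0 A : 2%:R != 0 :> k -> A \in oN k m ->
  (forall i j, (i + j < m)%N -> A i j = 0) -> A = 0.
Proof.
move=> two_neq0 Ao A0; apply/matrixP=> i j; rewrite mxE.
have [|mij|ijm] := ltngtP (i + j)%N m; first exact: A0.
  rewrite oN_anti // A0 ?oppr0 //=; have := ltn_ord i; have := ltn_ord j.
  by move: mij; lia.
have Er (a b : 'I_m.+1) : (a + b = m)%N -> rev_ord a = b.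
  by move=> E; apply: val_inj => /=; move: E; lia.
have := oN_anti i j Ao; rewrite (Er i j) // (Er j i) ?[(j + i)%N]addnC //.
move/eqP; rewrite -addr_eq0 -mulr2n -mulr_natl mulf_eq0 (negPf two_neq0) /=.
by move/eqP.
Qed.

Lemma Fmx_basis (i j i' j' : 'I_m.+1) : (i + j < m)%N -> (i' + j' < m)%N ->
  Fmx k i j i' j' = ((i, j) == (i', j'))%:R.
Proof.
move=> ij ij'; rewrite !mxE xpair_eqE (eq_sym i) (eq_sym j).
case: (andP (b1 := i' == rev_ord j)) => [[/eqP E1 /eqP E2]|_]; last by rewrite subr0.
by move: ij'; rewrite E1 E2 /=; have := ltn_ord i; have := ltn_ord j; lia.
Qed.

Definition basis_elt (a : I) : oNt k m := Ft k (val a.1).1 (val a.1).2 a.2.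

Definition coord_malg x : {malg k[I]} :=
  \sum_(r < size (poly_of_oNt x))
  \sum_(b : {ij : 'I_m.+1 * 'I_m.+1 | (ij.1 + ij.2 < m)%N})
    ((poly_of_oNt x)`_r (val b).1 (val b).2) *: zm ((b, nat_of_ord r) : I).

Lemma mcoeff_coord x (a : I) :
  (coord_malg x)@_a = (poly_of_oNt x)`_(a.2) (val a.1).1 (val a.1).2.
Proof.
rewrite /coord_malg raddf_sum; case: a => b r.
under eq_bigr => r' _ do rewrite raddf_sum /=.
have inner r' : \sum_(b' : {ij : 'I_m.+1 * 'I_m.+1 | (ij.1 + ij.2 < m)%N})
    ((poly_of_oNt x)`_r' (val b').1 (val b').2 *: zm ((b', r') : I))@_((b, r) : I)
  = (poly_of_oNt x)`_r' (val b).1 (val b).2 *+ (r' == r).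
  rewrite (bigD1 b) //= big1 ?addr0 => [|b' b'b].
    rewrite mcoeffZ mcoeff_zm -[_ == _ :> I]/((b == b) && (r' == r)) eqxx.
    by rewrite mulr_natr.
  rewrite mcoeffZ mcoeff_zm -[_ == _ :> I]/((b' == b) && (r' == r)).
  by rewrite (negPf b'b) mulr0.
under eq_bigr => r' _ do rewrite inner.
have [rx|xr] := ltnP r (size (poly_of_oNt x)).
  rewrite (bigD1 (Ordinal rx)) //= eqxx big1 ?addr0 // => r' r'r.
  by case: eqP => // E; case/eqP: r'r; apply: val_inj.
rewrite big1 /= => [|r' _]; first by rewrite nth_default // mxE.
by case: eqP => // E; have := ltn_ord r'; rewrite E ltnNge xr.
Qed.

Lemma coord_malg_linear : linear coord_malg.
Proof.
move=> c x y; apply/malgP=> a; rewrite mcoeffD mcoeffZ !mcoeff_coord /=.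
by rewrite coefD coefZ mxE -[_ * _]/(_ *m _) mul_scalar_mx mxE.
Qed.
HB.instance Definition _ := GRing.isLinear.Build k (oNt k m) {malg k[I]} _
  coord_malg coord_malg_linear.

Lemma coord_malg_basis (a : I) : coord_malg (basis_elt a) = zm a.
Proof.
apply/malgP=> a'; rewrite mcoeff_coord mcoeff_zm /= coefZ coefXn.
case: a a' => [[[i j] ij] r] [[[i' j'] ij'] r'] /=.
rewrite -[_ == _ :> I]/(((i, j) == (i', j')) && (r == r')).
case: (eqVneq r' r) => _; last by rewrite mulr0 mxE andbF.
by rewrite mulr1 Fmx_basis // andbT.
Qed.

Lemma coord_malg_inj : 2%:R != 0 :> k -> injective coord_malg.
Proof.
move=> two_neq0 x y xy; apply/eqP; rewrite -subr_eq0; apply/eqP/val_inj.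
apply/polyP=> r; rewrite coef0; apply: oN_eq0 => // [|i j ij].
  by have /polyOverP := oNtP (x - y); apply.
have := mcoeff_coord (x - y) ((exist _ (i, j) ij, r) : I).
by rewrite linearB /= xy subrr mcoeff0 => <-.
Qed.

End OrthogonalBasis.

(** * Center and p-map of the orthogonal algebra, and vanishing derivatives *)

Section OrthogonalAlgebra.
Variables (k : fieldType) (m : nat).
Local Notation I := (basis_idx m).
Local Notation M := 'M[k]_m.+1.
Implicit Types (a b c d i j : 'I_m.+1) (r : nat) (x y z : oNt k m) (A v : M).

Lemma mulmx_delta v a b c d : (v *m delta_mx a b) c d = v c a *+ (b == d).
Proof.
rewrite mxE (bigD1 a) //= big1 => [|l /negPf la]; rewrite mxE ?la ?mulr0 //.
by rewrite eqxx /= eq_sym addr0 mulr_natr.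
Qed.

Lemma delta_mulmx v a b c d : (delta_mx a b *m v) c d = v b d *+ (a == c).
Proof.
rewrite mxE (bigD1 b) //= big1 => [|l /negPf lb]; rewrite mxE ?lb ?andbF ?mul0r //.
by rewrite eqxx andbT eq_sym addr0 mulr_natl.
Qed.

Lemma exists_ord_neq2 a c : (1 < m)%N -> exists b, b != a /\ b != c.
Proof.
move=> m_gt1; have : (0 < #|~: [set a; c]|)%N.
  by rewrite cardsCs setCK card_ord cards2; case: (_ != _) => /=; lia.
by case/card_gt0P=> b; rewrite !inE negb_or => /andP[ba bc]; exists b.
Qed.

(** As $N\ge3$, an index $b$ avoiding two given ones exists. Comparing entries of
    $F_{a,b}v=vF_{a,b}$ then kills the off-diagonal entries and gives $v_{aa}=v_{bb}$ for $b\ne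
    a'$. *)
Lemma oN_center v : 2%:R != 0 :> k -> (1 < m)%N -> v \in oN k m ->
  (forall a b, Fmx k a b *m v = v *m Fmx k a b) -> v = 0.
Proof.
move=> two_neq0 m_gt1 vo vF.
have E a b c d : v c a *+ (b == d) - v c (rev_ord b) *+ (rev_ord a == d) =
    v b d *+ (a == c) - v (rev_ord a) d *+ (rev_ord b == c).
  have := congr1 (fun A : M => A c d) (vF a b).
  have entB (A B : M) : (A - B) c d = A c d - B c d by rewrite !mxE.
  by rewrite /Fmx mulmxBl mulmxBr !entB !mulmx_delta !delta_mulmx => ->.
have offdiag c a : c != a -> v c a = 0.
  move=> ca; have [b [ba bc]] := exists_ord_neq2 (rev_ord a) (rev_ord c) m_gt1.
  have := E a b c b; rewrite eqxx (eq_sym (rev_ord a)) (negPf ba).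
  rewrite (eq_sym a) (negPf ca) (can2_eq (@rev_ordK _) (@rev_ordK _)) (negPf bc).
  by rewrite !subr0.
have diag a b : b != rev_ord a -> v a a = v b b.
  move=> ba; have := E a b a b; rewrite !eqxx (eq_sym (rev_ord a)) (negPf ba).
  by rewrite (can2_eq (@rev_ordK _) (@rev_ordK _)) (negPf ba) !subr0.
apply/matrixP=> a c; rewrite mxE; have [->|/offdiag //] := eqVneq a c.
(* With $b\ne c,c'$ the entry $v_{cc}$ equals both $v_{bb}$ and $v_{b'b'}=-v_{bb}$. *)
have [b [bc bc']] := exists_ord_neq2 c (rev_ord c) m_gt1.
have := diag c (rev_ord b); rewrite (inj_eq rev_ord_inj) => /(_ bc) E1.
have := oN_anti (rev_ord b) (rev_ord b) vo.
rewrite !rev_ordK -E1 -(diag c b bc') => /eqP.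
rewrite -addr_eq0 -mulr2n -mulr_natl mulf_eq0 (negPf two_neq0) /=.
by move/eqP.
Qed.

(** If $i\ne j$ then $F^3=0$: the square is not always zero, since $i$ or $j$ may be the middle
    index. If $i=j$ then $F^3=F$, hence $F^p=F$ for odd $p$. *)
Lemma Fmx_exp i j p : odd p -> (2 < p)%N -> (i + j < m)%N ->
  Fmx k i j ^+ p = (i == j)%:R *: Fmx k i j.
Proof.
move=> p_odd p_gt2 ij.
have neqr a b : (a + b < m)%N -> (a == rev_ord b) = false.
  by move=> ab; apply/eqP => /(congr1 val) /= E; move: ab E; have := ltn_ord b; lia.
have ii : i = j -> (i == rev_ord i) = false by move=> E; apply: neqr; rewrite {2}E.
have deltaM a b c d : delta_mx a b * delta_mx c d = delta_mx a d *+ (b == c) :> M.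
  exact: mul_delta_mx_cond.
have sq : Fmx k i j ^+ 2 = delta_mx i j *+ (i == j)
    - delta_mx i (rev_ord i) *+ (j == rev_ord j)
    - delta_mx (rev_ord j) j *+ (i == rev_ord i)
    + delta_mx (rev_ord j) (rev_ord i) *+ (i == j).
  rewrite expr2 -[LHS]/(_ *m _) /Fmx mulmxBl !mulmxBr !mul_delta_mx_cond.
  rewrite (inj_eq rev_ord_inj) (eq_sym j i) (eq_sym (rev_ord i)) opprB.
  by rewrite addrA addrAC.
have [ij_eq|ij_neq] := eqVneq i j; last first.
  have cube : Fmx k i j ^+ 3 = 0.
    rewrite exprSr sq (negPf ij_neq) !mulr0n sub0r addr0 mulrBl mulNr !mulrnAl.
    rewrite /Fmx !mulrBr !deltaM.
    have : (i == rev_ord i) && (j == rev_ord j) = false.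
      apply/negP => /andP[/eqP/(congr1 val) /= E1 /eqP/(congr1 val) /= E2].
      by case/eqP: ij_neq; apply: val_inj; move: E1 E2 => /=; lia.
    rewrite (inj_eq rev_ord_inj) (eq_sym (rev_ord i) i) (eq_sym j i) (negPf ij_neq).
    by case: (i == rev_ord i); case: (j == rev_ord j) => //= _;
      rewrite !(mulr0n, mulr1n, subr0, oppr0, mul0rn, addr0).
  by rewrite -(subnK p_gt2) exprD cube mulr0 scale0r.
have cube : Fmx k i j * Fmx k i j ^+ 2 = Fmx k i j.
  rewrite sq -ij_eq eqxx (ii ij_eq) !mulr0n !subr0 /Fmx mulrBl !mulrDr !deltaM.
  by rewrite (eq_sym (rev_ord i)) (ii ij_eq) !eqxx !mulr0n addr0 add0r.
rewrite scale1r -(odd_double_half p) p_odd -muln2 mulnC exprS exprM.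
elim: (p./2) => [|q IHq]; first by rewrite expr0 mulr1.
by rewrite exprS mulrA cube.
Qed.

Lemma pmap_basis p (a : I) : odd p -> (2 < p)%N ->
  Defs.pmap p (basis_elt k a) = ((val a.1).1 == (val a.1).2)%:R *:
    Ft k (val a.1).1 (val a.1).2 (a.2 * p).
Proof.
move=> p_odd p_gt2; apply: val_inj; rewrite /= val_pmap //=.
rewrite -mul_polyC exprMn_comm; last exact: commr_polyXn.
rewrite -exprM -polyC_exp mul_polyC Fmx_exp //; last exact: (valP a.1).
by rewrite scalerA -[_%:M * _]/(_ *m _) mul_scalar_mx.
Qed.

Lemma oN_lie A v : A \in oN k m -> v \in oN k m -> A * v - v * A \in oN k m.
Proof.
move=> Ao vo; have /polyOverP/(_ 0%N) := lie_oNt_subproof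
  (ONt (xt_subproof 0 Ao)) (ONt (xt_subproof 0 vo)).
by rewrite /= !monom_mul coefB !coefZ coefXn !mulr1.
Qed.

Lemma coord_lie_Ft i j s (a t : I) :
  (coord_malg (lie_oNt (Ft k i j s) (basis_elt k a)))@_t =
  (Fmx k i j * Fmx k (val a.1).1 (val a.1).2
   - Fmx k (val a.1).1 (val a.1).2 * Fmx k i j) (val t.1).1 (val t.1).2
  *+ (t.2 == a.2 + s)%N.
Proof.
rewrite mcoeff_coord /= !monom_mul [(s + _)%N]addnC -scalerBl coefZ coefXn.
by case: eqP => _; rewrite ?mulr1 // mulr0 mxE.
Qed.

Lemma entry_linear i j : linear (fun A : M => A i j : k^o).
Proof. by move=> c A B; rewrite !mxE. Qed.

Lemma commutator_entry_linear A i j :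
  linear (fun v => (A * v - v * A) i j : k^o).
Proof.
move=> c u v; rewrite mulrDr mulrDl -scalerAl -scalerAr opprD addrACA -scalerBr.
exact: entry_linear.
Qed.

Lemma polar_dvd (le : rel I) p (f : symalg k I) (d : nat) :
  total le -> transitive le -> antisymmetric le ->
  p \in [pchar k] -> 2%:R != 0 :> k -> (1 < m)%N ->
  (forall x t (mu : {cmonom I}), (mdeg mu).+1 = d -> mu t = 0%N ->
    (forall nu, nu \in ssupp f -> nu t = 0%N) ->
    polar le f mu
      (fun a : I => (coord_malg (lie_oNt x (basis_elt k a)))@_t : k^o) = 0) ->
  forall mu, mdeg mu = d -> mu \in ssupp f -> forall a : I, (p %| mu a)%N.
Proof.
move=> le_total le_trans le_anti charp two_neq0 m_gt1 fP mu mud muf a.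
have [->|mua] := eqVneq (mu a) 0%N; first exact: dvdn0.
pose nu := divcm mu (ucm a).
have muE : mu = mmul (ucm a) nu.
  apply/eqP/cmP=> b; rewrite cmM cmU divcmE cmU; case: eqVneq => [<-|_].
    by rewrite addnC subnK // lt0n.
  by rewrite subn0.
(* Larger than every power of $t$ in $f$, so that variables with $t^s$ or higher powers are
   fresh. *)
pose s := (\max_(mu' <- ssupp f) \max_(b <- cseq le mu') b.2).+1.
have high mu' (b : I) : mu' \in ssupp f -> (s <= b.2)%N -> mu' b = 0%N.
  move=> mu'f; apply: contraTeq; rewrite -(mem_cseq le) -ltnNge ltnS => bmu'.
  have le1 := @leq_bigmax_seq {cmonom I} (ssupp f) xpredT
    (fun mu' => \max_(b <- cseq le mu') b.2)%N mu' mu'f isT.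
  have le2 := @leq_bigmax_seq I (cseq le mu') xpredT snd b bmu' isT.
  exact: leq_trans le2 le1.
(* Bracketing with $Ft^s$ shifts the powers of $t$ uniformly, so the conditions separate and only
   the variables with the same power of $t$ as $a$ are kept. *)
pose h (b : I) : M := (b.2 == a.2)%:R *: Fmx k (val b.1).1 (val b.1).2.
pose v := polar le f nu h.
have vo : v \in oN k m.
  by apply: rpred_sum => mu' _; apply: rpred_sum => b _; rewrite !memvZ // Fmx_oN.
have v0 : v = 0.
  apply: oN_center => // i j; apply/eqP; rewrite -subr_eq0; apply/eqP.
  apply: oN_eq0 => // [|c1 c2 c12]; first exact: oN_lie (Fmx_oN _ _ _) vo.
  (* The coefficient at this fresh variable is the entry $(c_1,c_2)$ of $[F_{i,j},v]$. *)
  pose t : I := (exist _ (c1, c2) c12, a.2 + s)%N.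
  have nut : nu t = 0%N by rewrite divcmE high // leq_addl.
  have nud : (mdeg nu).+1 = d by rewrite -mud muE mdegM mdegU.
  have fP0 := fP (Ft k i j s) t nu nud nut
    (fun mu' mu'f => high mu' t mu'f (leq_addl _ _)).
  pose phi : {linear M -> k^o} := HB.pack
    (fun v => (Fmx k i j * v - v * Fmx k i j) c1 c2 : k^o)
    (GRing.isLinear.Build k M k^o _ _ (commutator_entry_linear (Fmx k i j) c1 c2)).
  rewrite -[LHS]/(phi v) /v linear_polar -[RHS]fP0.
  apply: (@eq_polar k _ le k^o f nu (phi \o h)) => b.
  rewrite coord_lie_Ft /= /h eqn_add2r (eq_sym a.2).
  by rewrite -scalerAr -scalerAl -scalerBr mxE mulr_natl.
pose phi : {linear M -> k^o} := HB.pack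
  (fun A : M => A (val a.1).1 (val a.1).2 : k^o)
  (GRing.isLinear.Build k M k^o _ _ (entry_linear (val a.1).1 (val a.1).2)).
have : phi v = 0 by rewrite v0 linear0.
(* The entry of $v$ at the position of $a$ is the coefficient of [mu] in $f$ times the exponent
   [mu a]. *)
rewrite /v linear_polar (@eq_polar _ _ _ _ _ _ _ (fun b : I => (b == a)%:R : k^o)).
  rewrite polar_delta // -muE -mulr_natr => E.
  have {E} : scoef mu f * (mu a)%:R == 0 :> k by apply/eqP.
  rewrite -scoef_neq0 in muf.
  by rewrite mulf_eq0 (negPf muf) (dvdn_pcharf charp).
move=> b; rewrite /= /h mxE Fmx_basis ?(valP b.1) ?(valP a.1) //.
rewrite -!surjective_pairing (inj_eq val_inj) -natrM mulnb andbC.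
by rewrite -[b == a]/((b.1 == a.1) && (b.2 == a.2)).
Qed.

End OrthogonalAlgebra.

(* An arbitrary total order, to fix the ordered monomials of the PBW basis. *)
Definition basis_le m : rel (basis_idx m) :=
  fun a b => (choice.pickle (a : {ij : 'I_m.+1 * 'I_m.+1 | (ij.1 + ij.2 < m)%N} * nat)
    <= choice.pickle (b : {ij : 'I_m.+1 * 'I_m.+1 | (ij.1 + ij.2 < m)%N} * nat))%N.

Lemma basis_le_total m : total (@basis_le m).
Proof. by move=> a b; apply: leq_total. Qed.

Lemma basis_le_trans m : transitive (@basis_le m).
Proof. by move=> a b c; apply: leq_trans. Qed.

Lemma basis_le_anti m : antisymmetric (@basis_le m).
Proof. by move=> a b; rewrite -eqn_leq => /eqP/(pcan_inj choice.pickleK). Qed.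

Theorem theorem2p2 (k : closedFieldType) (p : nat)
    (char_k : p \in [pchar k]) (p_gt3 : (3 < p)%N)
    (n m : nat)
    (typeBD : (1 <= n)%N /\ m.+1 = (2 * n + 1)%N \/
              (2 <= n)%N /\ m.+1 = (2 * n)%N)
    (U : algType k) (iota : oNt k m -> U)
    (envU : is_enveloping (@lie_oNt k m) iota) :
  (forall z : U, central z <-> p_center iota p z) /\
  freely_generates (@p_center_gen k m U iota p) (@central U).
Proof.
have p_pr := pcharf_prime char_k.
have p_odd : odd p by have [p2|//] := even_prime p_pr; rewrite p2 in p_gt3.
have m_gt1 : (1 < m)%N by case: typeBD => -[]; lia.
have two_neq0 : 2%:R != 0 :> k.
  by rewrite -(dvdn_pcharf char_k); apply/negP => /dvdn_leq; lia.
have cof_inj := @coord_malg_inj k m two_neq0.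
have charU : p \in [pchar U] by rewrite (pchar_lalg U).
have charM : p \in [pchar {poly 'M[k]_m.+1}].
  by rewrite pchar_poly (pchar_lalg 'M[k]_m.+1).
pose iotaL : {linear oNt k m -> U} :=
  HB.pack iota (GRing.isLinear.Build k _ _ _ iota envU.1.1).
have iotaZ c x : iota (c *: x) = c *: iota x := linearZ_LR iotaL c x.
have p_central x : central (iota x ^+ p - iota (Defs.pmap p x)).
  apply: (central_iota (@basis_le_total m) (@basis_le_trans m) (@basis_le_anti m)
    cof_inj (@coord_malg_basis k m) (@lie_oNt_linl k m) (@lie_oNt_linr k m)
    (@lie_oNt_alt k m) (@lie_oNt_jacobi k m) envU) => y.
  have adE q : iter q (ad (iota x)) (iota y) = iota (iter q (lie_oNt x) y).
    by elim: q => //= q ->; rewrite /ad -envU.1.2.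
  (* In $M_N(\Bbbk)[t]$ the $p$-map is the true $p$-th power, so $\mathrm{ad}(x)^p=\mathrm{ad}(x^p)$
     there computes the iterated bracket; the same identity in $U$ then compares it with
     $\iota(x)^p$. *)
  have liep : iter p (lie_oNt x) y = lie_oNt (Defs.pmap p x) y.
    apply: val_inj; rewrite /= val_pmap // -(iter_ad_pchar _ _ charM).
    by elim: (p) => //= q ->.
  have := iter_ad_pchar (iota x) (iota y) charU.
  rewrite adE liep envU.1.2 => /eqP; rewrite eq_sym subr_eq => /eqP E.
  by rewrite mulrBl mulrBr E addrAC (addrAC (_ * _)) subrr sub0r addrC.
pose lower a := Defs.pmap p (@basis_elt k m a).
have [] := enveloping_center (@basis_le_total m) (@basis_le_trans m)
    (@basis_le_anti m) cof_inj (@coord_malg_basis k m) (@lie_oNt_linl k m) (@lie_oNt_linr k m)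
    (@lie_oNt_alt k m) (@lie_oNt_jacobi k m) envU (lower := lower) (prime_gt1 p_pr).
- by move=> a; apply: p_central.
- move=> f d; apply: polar_dvd => //.
  + exact: basis_le_total.
  + exact: basis_le_trans.
  + exact: basis_le_anti.
move=> [phi [phiE phi_inj phi_im]] gen; split=> [z|].
  split=> [cz|]; first by apply: gen cz => a; exists (basis_elt k a).
  (* The $p$-center is central because its generators, for all $x$ and not only basis elements, are
     so by [p_central]. *)
  elim=> {z} [_ [x ->]|c|a b _ ca _ cb|a b _ ca _ cb] //.
  - by move=> u; rewrite -scalerAl -scalerAr mul1r mulr1.
  - by move=> u; rewrite mulrDl mulrDr ca cb.
  - by move=> u; rewrite -mulrA cb !mulrA ca.
exists phi; split=> // a; rewrite phiE /xi /p_center_gen /lower.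
rewrite pmap_basis //; last lia.
by case: a => [[[i j] ij] r] /=; rewrite iotaZ.
Qed.
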